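(* Let $n\in\{4,5\}$ and let $H\subset\mathbb{R}^2$ be a compact convex set with non-empty interior. Let $H^{\mathsf{Sym}}$ and $H^{\mathsf{Sha}}$ be obtained from $H$ by Steiner symmetrization and by shaking, respectively, with respect to the $x$-axis. Then $$Q^n_{H^{\mathsf{Sym}}}\geq Q^n_{H},\qquad Q^n_{H^{\mathsf{Sha}}}\leq Q^n_{H}.$$
   Context: For a compact convex set $H\subset\mathbb{R}^2$ with non-empty interior, $Q^n_H$ denotes the probability that $n$ independent uniform random points in $H$ are in convex position (i.e. they are distinct and are exactly the vertices of a convex polygon). Let $x_{\min}(H)$ and $x_{\max}(H)$ be the minimum and maximum abscissas of points of $H$. For $x\in[x_{\min}(H),x_{\max}(H)]$ let $\overline{y}_x(H)=\sup\{y:(x,y)\in H\}$, $\underline{y}_x(H)=\inf\{y:(x,y)\in H\}$ and $W_H(x)=\overline{y}_x(H)-\underline{y}_x(H)$. Then $$H^{\mathsf{Sym}}=\{(x,y): x_{\min}(H)\leq x\leq x_{\max}(H),\ |y|\leq W_H(x)/2\},$$ $$H^{\mathsf{Sha}}=\{(x,y): x_{\min}(H)\leq x\leq x_{\max}(H),\ 0\leq y\leq W_H(x)\}.$$ *)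

(* Defs.v *)
From HB Require Import structures.
From mathcomp Require Import all_boot all_order all_algebra.
From mathcomp Require Import all_classical all_reals all_analysis.

Set Implicit Arguments.
Unset Strict Implicit.
Unset Printing Implicit Defensive.

Import Order.TTheory GRing.Theory Num.Theory.
Import numFieldNormedType.Exports.

Local Open Scope classical_set_scope.
Local Open Scope ring_scope.

Section iid.
Local Open Scope ereal_scope.
Context {d : measure_display} {T : measurableType d} {R : realType}.

Definition tuple_cons (n : nat) (p : T * n.-tuple T) : n.+1.-tuple T :=
  [the n.+1.-tuple T of p.1 :: p.2].

Lemma measurable_tuple_cons n : measurable_fun [set: T * n.-tuple T] (@tuple_cons n).
Proof. exact: measurable_cons. Qed.

HB.instance Definition _ n :=
  isMeasurableFun.Build _ _ _ _ (@tuple_cons n) (@measurable_tuple_cons n).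

(* The n-fold product measure of P; see iid_lawE. *)
Fixpoint iid_law (P : probability T R) (n : nat) : probability (n.-tuple T) R :=
  match n with
  | 0%N => \d_[tuple]
  | k.+1 => distribution (P \x iid_law P k) (@tuple_cons k)
  end.

Lemma iid_lawE (P : probability T R) (n : nat) (A : 'I_n -> set T) :
  (forall i, measurable (A i)) ->
  iid_law P n [set t | forall i, A i (tnth t i)] = \prod_(i < n) P (A i).
Proof.
elim: n A => [|n IH] A mA.
  by rewrite big_ord0 /= diracE mem_set// => -[].
rewrite big_ord_recl /= /distribution /pushforward.
rewrite (_ : _ @^-1` _ =
    A ord0 `*` [set t | forall i, A (lift ord0 i) (tnth t i)]); last first.
  apply/seteqP; split=> -[x t] /=.
    move=> h; split=> [|i]; first by have := h ord0; rewrite tnth0.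
    by have := h (lift ord0 i); rewrite tnthS.
  move=> -[h0 h] i; have [->|[j ->]] : i = ord0 \/ exists j, i = lift ord0 j.
    by case: (unliftP ord0 i) => [j ->|->]; [right; exists j|left].
    by rewrite tnth0.
  by rewrite tnthS.
rewrite product_measure1E//; last first.
  rewrite (_ : [set t | _] = \bigcap_(i in [set: 'I_n])
      ((fun t : n.-tuple T => tnth t i) @^-1` A (lift ord0 i))); last first.
    by apply/seteqP; split=> [t h i _|t h i]; [exact: h|exact: (h i)].
  apply: fin_bigcap_measurable => // i _.
  by rewrite -[X in measurable X]setTI; exact: measurable_tnth.
by congr (_ * _); exact: (IH (fun i => A (lift ord0 i))).
Qed.

End iid.

Section plane.
Context {R : realType}.
(* lebesgue_measure lives on measurableTypeR R, whose measurable structure is not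
   syntactically the canonical one of R. *)
Local Notation mR := (measurableTypeR R).

Definition convex_hull (A : set (R * R)) : set (R * R) :=
  smallest (@convex_set R (R * R)%type) A.

(* For a convex polygon, the vertices are the extreme points. *)
Definition vertices (A : set (R * R)) : set (R * R) :=
  [set x | A x /\ forall (a b : R * R) (t : R), A a -> A b -> 0 < t < 1 ->
           x = t *: a + (1 - t) *: b -> a = x /\ b = x].

(* Points and segments are not excluded, but they have at most two vertices, so
   convex_position below is unaffected for tuples of at least three points. *)
Definition convex_polygon (P : set (R * R)) : Prop :=
  exists2 V : set (R * R), finite_set V & P = convex_hull V.

Definition convex_position (n : nat) (t : n.-tuple (R * R)) : Prop :=
  uniq t /\
  exists2 P : set (R * R), convex_polygon P & vertices P = [set` t].

Definition lebesgue_plane : {measure set (mR * mR) -> \bar R} :=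
  (@lebesgue_measure R \x @lebesgue_measure R)%E.

Lemma lebesgue_planeX (A B : set mR) : measurable A -> measurable B ->
  lebesgue_plane (A `*` B) = (lebesgue_measure A * lebesgue_measure B)%E.
Proof. by move=> mA mB; exact: product_measure1E. Qed.

(* The Dirac masses only make uniform_law total; by uniform_lawE they play no role
   when H is compact with non-empty interior. *)
Definition uniform_law (H : set (mR * mR)) : probability (mR * mR)%type R :=
  match pselect (measurable H) with
  | left mH => mnormalize (mrestr lebesgue_plane mH) \d_((0%R, 0%R) : mR * mR)
  | right _ => \d_((0%R, 0%R) : mR * mR)
  end.

Let measurable_ball (x r : R) : 0 < r -> measurable (ball x r : set mR).
Proof. by move=> r0; rewrite ball_itv; exact: measurable_itv. Qed.

Lemma open_plane_measurable (O : set (R * R)) :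
  open O -> measurable (O : set (mR * mR)).
Proof.
move=> oO.
pose B (q : rat * rat * nat) : set (R * R) :=
  ball (ratr q.1.1 : R) q.2.+1%:R^-1 `*` ball (ratr q.1.2 : R) q.2.+1%:R^-1.
rewrite (_ : O = \bigcup_(q in [set q | B q `<=` O]) B q); last first.
  apply/seteqP; split=> [x Ox|x [q /= sq Bx]]; last exact: sq.
  have /nbhs_ballP[e /= e0 eO] : nbhs x O by exact: open_nbhs_nbhs.
  have [k ke] : exists k : nat, k.+1%:R^-1 < e / 2.
    have /ltr_add_invr[k] : 0 < e / 2 by rewrite divr_gt0.
    by rewrite add0r; exists k.
  have rk (y : R) : exists q : rat, ball (ratr q : R) k.+1%:R^-1 y.
    have /rat_in_itvoo[q] : y < y + k.+1%:R^-1 by rewrite ltrDl.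
    rewrite in_itv/= => /andP[yq qy]; exists q.
    by rewrite /ball /= gtr0_norm ?subr_gt0// ltrBlDl.
  have [q1 h1] := rk x.1; have [q2 h2] := rk x.2.
  exists (q1, q2, k) => //= -[z1 z2] [/= hz1 hz2]; apply: eO; split => /=.
    by apply: (@ball_splitr _ R (ratr q1 : R)); exact: le_ball (ltW ke) _ _.
  by apply: (@ball_splitr _ R (ratr q2 : R)); exact: le_ball (ltW ke) _ _.
rewrite bigcup_mkcond; apply: countable_bigcupT_measurable => // q.
by case: ifP => // _; apply: measurableX; exact: measurable_ball.
Qed.

Lemma compact_plane_measurable (H : set (R * R)) :
  compact H -> measurable (H : set (mR * mR)).
Proof.
move=> cH; rewrite -[H]setCK; apply: measurableC; apply: open_plane_measurable.
by apply: closed_openC; apply: compact_closed => //; exact: norm_hausdorff.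
Qed.

Lemma lebesgue_plane_compact_lty (H : set (R * R)) :
  compact H -> (lebesgue_plane H < +oo)%E.
Proof.
move=> cH; have [M [_ HM]] := compact_bounded cH.
pose N : R := Num.max 0 M + 1.
have MN : M < N by rewrite ltr_pwDr// le_max lexx orbT.
have N0 : 0 < N by rewrite ltr_pwDr// le_max lexx.
have sH : H `<=` `[- N, N] `*` `[- N, N].
  move=> x /(HM _ MN); rewrite /= prod_normE ge_max => /andP[h1 h2].
  by split; rewrite /= in_itv/= -ler_norml.
apply: (@le_lt_trans _ _ (lebesgue_plane (`[- N, N] `*` `[- N, N]))).
  apply: le_measure; rewrite ?inE//; first exact: compact_plane_measurable.
  exact: measurableX.
rewrite lebesgue_planeX// lebesgue_measure_itv/= lte_fin.
by rewrite gtrN// -EFinD -EFinM ltry.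
Qed.

Lemma lebesgue_plane_interior_gt0 (H : set (R * R)) :
  measurable (H : set (mR * mR)) -> H° !=set0 -> (0 < lebesgue_plane H)%E.
Proof.
move=> mH [x /nbhs_ballP[e /= e0 eH]].
have sH : ball x.1 e `*` ball x.2 e `<=` H by move=> y ?; exact: eH.
apply: (@lt_le_trans _ _ (lebesgue_plane (ball x.1 e `*` ball x.2 e))).
  rewrite lebesgue_planeX; [|exact: measurable_ball..].
  rewrite !lebesgue_measure_ball ?(ltW e0)//.
  by rewrite -EFinM lte_fin mulr_gt0// mulrn_wgt0.
apply: le_measure; rewrite ?inE//.
by apply: measurableX; exact: measurable_ball.
Qed.

Lemma uniform_lawE (H A : set (R * R)) : compact H -> H° !=set0 ->
  uniform_law H A =
  (lebesgue_plane (A `&` H) * ((fine (lebesgue_plane H))^-1)%:E)%E.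
Proof.
move=> cH iH; have mH := compact_plane_measurable cH.
rewrite /uniform_law; case: pselect => [mH'|//].
have HT : mrestr lebesgue_plane mH' [set: mR * mR] = lebesgue_plane H.
  by rewrite /mrestr setTI.
have H0 := lebesgue_plane_interior_gt0 mH iH.
have Hoo := lebesgue_plane_compact_lty cH.
rewrite -[LHS]/(mnormalize (mrestr lebesgue_plane mH') _ A) /mnormalize.
case: ifPn => [/orP[/eqP E|/eqP E]|_].
- by move: H0; rewrite -(etrans (esym E) HT) ltxx.
- by move: Hoo; rewrite -(etrans (esym E) HT) ltxx.
- by congr (_ * ((fine _)^-1)%:E)%E; exact: HT.
Qed.

Definition Q (n : nat) (H : set (R * R)) : \bar R :=
  iid_law (uniform_law H) n [set t | convex_position t].

Definition xmin (H : set (R * R)) : R := inf [set p.1 | p in H].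
Definition xmax (H : set (R * R)) : R := sup [set p.1 | p in H].

Definition ytop (H : set (R * R)) (x : R) : R := sup [set y | H (x, y)].
Definition ybot (H : set (R * R)) (x : R) : R := inf [set y | H (x, y)].
Definition W (H : set (R * R)) (x : R) : R := ytop H x - ybot H x.

Definition Sym (H : set (R * R)) : set (R * R) :=
  [set p | xmin H <= p.1 <= xmax H /\ `|p.2| <= W H p.1 / 2].
Definition Sha (H : set (R * R)) : set (R * R) :=
  [set p | xmin H <= p.1 <= xmax H /\ 0 <= p.2 <= W H p.1].

End plane.

(* Main.v *)
From HB Require Import structures.
Require Import Defs.
From mathcomp Require Import all_boot all_order all_algebra.
From mathcomp Require Import all_classical all_reals all_analysis.
From mathcomp Require Import measurable_realfun ring lra.
Import Order.TTheory GRing.Theory Num.Theory.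
Import numFieldNormedType.Exports.
Local Open Scope classical_set_scope.
Local Open Scope ring_scope.
Set Implicit Arguments.
Unset Strict Implicit.
Unset Printing Implicit Defensive.

(* Given abscissas x1 < x2 < x3, the ordinates of three random points of a body whose
   vertical chords are [g - w/2, g + w/2] are independent and uniform. The defect of
   concavity d of g at x1, x2, x3 enters the relative area T of the triangle only
   through its square: as the chord joining the outer two points meets the vertical
   chord over x2, the mean of |y2 - chord| over y2 is a quadratic polynomial, and the
   reflection y -> -y kills the cross terms. Up to terms depending on w only, with X =
   x3 - x1 and A the area, E T integrates d^2 / (2 A X w(x2)) and E T^2 integrates
   d^2 / (4 A^2); moreover X w(x2) <= 2 A. Hence E T and E T - E T^2 increase with |d|.
   Symmetrization makes d = 0, while for shaking |d| is the largest value allowed by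
   convexity.

   For points in general position, 1 - Q^4 = 4 E T, and Q^5 = 1 - 10 E T + 10 E T^2
   follows by counting pairs of a triangle and a point inside it, and triangles
   containing both other points. *)

(** * Convex position in the plane *)

(** Bodies with the same vertical widths differ by a shear (x, y) -> (x, y + g x), which preserves
    area, so all samples can be drawn from one law on the symmetric body. Such a shear does not
    preserve lines; hence only the vertices are sheared, and the triangle they span is straight. For
    fixed abscissas its determinant is linear in the ordinates, so g enters only through its defect
    of concavity, and bodies are compared by pointwise inequalities between integrands on a common
    space.

    By convexity a triangle with vertices in the body stays inside it, so T is the chance that one
    further point hits it; this turns E T and E T^2 into probabilities about four and five points.
    The averaging over y2 serves E T alone, since T^2 is already a polynomial.

    The counting identities depend only on the orientations of triples, so they are checked on
    finitely many sign vectors. Two algebraic identities between determinants exclude enough of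
    these; realizability itself is never decided.

    Values are extended reals, so inequalities between differences are stated with all terms added
    on the proper side. Quantities appear doubled because a function is added to its reflection. *)

Section planar_geometry.
Context {R : realType}.
Implicit Types a b c p q : R * R.

(** Twice the signed area of the triangle, positive when [a], [b], [c] turn counterclockwise. *)
Definition det3 a b c : R :=
  (b.1 - a.1) * (c.2 - a.2) - (c.1 - a.1) * (b.2 - a.2).

(** The three determinants sum to [det3 a b c], so a common strict sign means positive barycentric
    coordinates. The sides are excluded, and both orientations of the triangle are allowed. *)
Definition in_triangle a b c p : bool :=
  [&& 0 < det3 p b c, 0 < det3 a p c & 0 < det3 a b p] ||
  [&& det3 p b c < 0, det3 a p c < 0 & det3 a b p < 0].

Lemma det3C12 a b c : det3 b a c = - det3 a b c.
Proof. rewrite /det3; ring. Qed.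

Lemma det3C23 a b c : det3 a c b = - det3 a b c.
Proof. rewrite /det3; ring. Qed.

Lemma convex_setP (A : set (R * R)) : convex_set A <->
  forall a b (s : R), A a -> A b -> 0 <= s <= 1 ->
    A (s * a.1 + (1 - s) * b.1, s * a.2 + (1 - s) * b.2).
Proof.
split=> [cA a b s Aa Ab /andP[s0 s1]|cA a b s /set_mem Aa /set_mem Ab].
  by have := cA a b (Itv01 s0 s1) (mem_set Aa) (mem_set Ab); move/set_mem.
by apply/mem_set; apply: (cA a b s%:num) => //; rewrite ge0 le1.
Qed.

Lemma convex_hull_convex (A : set (R * R)) : convex_set (convex_hull A).
Proof.
apply/convex_setP => a b s ha hb s01 C [cC AC]; have /convex_setP := cC; apply=> //.
- exact: ha.
- exact: hb.
Qed.

Lemma sub_convex_hull (A : set (R * R)) : A `<=` convex_hull A.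
Proof. by move=> x Ax C [_]; apply. Qed.

Lemma convex_hull_min (A C : set (R * R)) :
  convex_set C -> A `<=` C -> convex_hull A `<=` C.
Proof. by move=> cC AC x; apply. Qed.

Lemma verticesP (A : set (R * R)) p : vertices A p <->
  A p /\ forall a b (s : R), A a -> A b -> 0 < s < 1 ->
    p = (s * a.1 + (1 - s) * b.1, s * a.2 + (1 - s) * b.2) -> a = p /\ b = p.
Proof. by []. Qed.

(** Removing an extreme point from a convex set leaves it convex; were the point outside [A], the
    smaller set would still contain [A]. *)
Lemma vertices_convex_hull (A : set (R * R)) : vertices (convex_hull A) `<=` A.
Proof.
move=> p /verticesP[hp ex]; apply: contrapT => nAp.
suff sub : convex_hull A `<=` convex_hull A `\ p.
  by have [_] := sub p hp; apply.
apply: convex_hull_min; last first.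
  move=> x Ax.
  by split; [exact: sub_convex_hull|move=> xp; apply: nAp; rewrite -xp].
apply/convex_setP => a b s [ha /= nap] [hb /= nbp] /andP[s0 s1].
have [->|sN0] := eqVneq s 0.
  by rewrite !mul0r subr0 !mul1r !add0r -surjective_pairing.
have [->|sN1] := eqVneq s 1.
  by rewrite subrr !mul0r !mul1r !addr0 -surjective_pairing.
split.
  by have /convex_setP := @convex_hull_convex A; apply => //; rewrite s0.
move=> /= e; have [|//] := ex a b s ha hb _ (esym e).
by rewrite !lt_neqAle eq_sym sN0 s0 sN1.
Qed.

(* The points on the positive side of the line through p and k together with a
   ray of that line starting at p form a convex set of which p is a vertex. *)
Lemma vertex_of_half_plane (P : set (R * R)) p k : k != p -> P p ->
  (forall q, P q -> 0 < det3 p k q \/ det3 p k q = 0 /\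
     0 <= (q.1 - p.1) * (k.1 - p.1) + (q.2 - p.2) * (k.2 - p.2)) ->
  vertices P p.
Proof.
move=> kp Pp h; apply/verticesP; split=> // a b s /h ha /h hb /andP[s0 s1] e.
(* [D q] is the scalar product of q - p with k - p. Together with [det3 p k q] it determines q - p,
   the two being orthogonal coordinates scaled by the length of k - p. *)
pose D q := (q.1 - p.1) * (k.1 - p.1) + (q.2 - p.2) * (k.2 - p.2).
have eL : s * det3 p k a + (1 - s) * det3 p k b = 0.
  transitivity (det3 p k (s * a.1 + (1 - s) * b.1, s * a.2 + (1 - s) * b.2)).
    by rewrite /det3/=; ring.
  by rewrite -e /det3; ring.
have eD : s * D a + (1 - s) * D b = 0.
  transitivity (D (s * a.1 + (1 - s) * b.1, s * a.2 + (1 - s) * b.2)).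
    by rewrite /D/=; ring.
  by rewrite -e /D; ring.
have {}s1 : 0 < 1 - s by rewrite subr_gt0.
have convex_eq0 (x y : R) : 0 <= x -> 0 <= y -> s * x + (1 - s) * y = 0 ->
    x = 0 /\ y = 0.
  move=> x0 y0 /eqP; rewrite paddr_eq0 ?mulr_ge0 ?(ltW s0) ?(ltW s1)//.
  by rewrite !mulf_eq0 (gt_eqF s0) (gt_eqF s1) /= => /andP[/eqP-> /eqP->].
have ge0L q : 0 < det3 p k q \/ det3 p k q = 0 /\ 0 <= D q -> 0 <= det3 p k q.
  by case=> [/ltW//|[->]].
have [La Lb] := convex_eq0 _ _ (ge0L _ ha) (ge0L _ hb) eL.
have [Da Db] : D a = 0 /\ D b = 0.
  apply: convex_eq0 => //.
    by case: ha => [|[]//]; rewrite La ltxx.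
  by case: hb => [|[]//]; rewrite Lb ltxx.
have n0 : (k.1 - p.1) ^+ 2 + (k.2 - p.2) ^+ 2 != 0.
  apply: contra_neq kp => /eqP; rewrite paddr_eq0 ?sqr_ge0// !sqrf_eq0 !subr_eq0.
  by case: k p {h D eL eD convex_eq0 ge0L La Lb Da Db ha hb e Pp} => k1 k2 [p1 p2] /= /andP[/eqP-> /eqP->].
suff ortho q : det3 p k q = 0 -> D q = 0 -> q = p by split; exact: ortho.
move=> Lq Dq; rewrite [q]surjective_pairing [p]surjective_pairing.
congr pair; apply/eqP; rewrite -subr_eq0 -(mulrI_eq0 _ (mulfI n0)); apply/eqP.
  transitivity ((k.1 - p.1) * D q - (k.2 - p.2) * det3 p k q).
    by rewrite /D /det3; ring.
  by rewrite Lq Dq !mulr0 subr0.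
transitivity ((k.2 - p.2) * D q + (k.1 - p.1) * det3 p k q).
  by rewrite /D /det3; ring.
by rewrite Lq Dq !mulr0 addr0.
Qed.

(** Membership says that the pair of [det3 p k q] and the scalar product of q - p with k - p is
    lexicographically nonnegative, and such pairs are closed under convex combinations. *)
Lemma convex_half_plane p k : convex_set
  [set q | 0 < det3 p k q \/ det3 p k q = 0 /\
     0 <= (q.1 - p.1) * (k.1 - p.1) + (q.2 - p.2) * (k.2 - p.2)].
Proof.
apply/convex_setP => a b s /= ha hb /andP[s0 s1].
have eL : det3 p k (s * a.1 + (1 - s) * b.1, s * a.2 + (1 - s) * b.2) =
  s * det3 p k a + (1 - s) * det3 p k b by rewrite /det3 /=; ring.
have eD : (s * a.1 + (1 - s) * b.1 - p.1) * (k.1 - p.1) +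
    (s * a.2 + (1 - s) * b.2 - p.2) * (k.2 - p.2) =
  s * ((a.1 - p.1) * (k.1 - p.1) + (a.2 - p.2) * (k.2 - p.2)) +
  (1 - s) * ((b.1 - p.1) * (k.1 - p.1) + (b.2 - p.2) * (k.2 - p.2)) by ring.
rewrite eL eD; move: ha hb.
set La := det3 p k a; set Lb := det3 p k b; set Da := _ + _; set Db := _ + _.
move=> ha hb.
have [->|sN0] := eqVneq s 0; first by rewrite !mul0r !add0r subr0 !mul1r.
have [->|sN1] := eqVneq s 1; first by rewrite subrr !mul0r !addr0 !mul1r.
have {}s0 : 0 < s by rewrite lt_neqAle eq_sym sN0.
have {}s1 : 0 < 1 - s by rewrite subr_gt0 lt_neqAle sN1.
case: ha => [La0|[-> Da0]]; case: hb => [Lb0|[-> Db0]].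
- by left; rewrite addr_gt0 ?mulr_gt0.
- by left; rewrite mulr0 addr0 mulr_gt0.
- by left; rewrite mulr0 add0r mulr_gt0.
- by right; rewrite !mulr0 addr0; split=> //; rewrite addr_ge0 ?mulr_ge0 ?(ltW s0) ?(ltW s1).
Qed.

(** Of three distinct collinear points, one lies strictly between the other two and cannot be
    extreme. *)
Lemma vertices_noncollinear (P : set (R * R)) a b c :
  vertices P a -> vertices P b -> vertices P c ->
  a != b -> a != c -> b != c -> det3 a b c != 0.
Proof.
move=> /verticesP[Pa va] /verticesP[Pb vb] /verticesP[Pc vc] ab ac bc.
apply/eqP => abc0.
pose N := (b.1 - a.1) ^+ 2 + (b.2 - a.2) ^+ 2.
have N0 : N != 0.
  apply: contra_neq ab => /eqP; rewrite paddr_eq0 ?sqr_ge0// !sqrf_eq0 !subr_eq0.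
  by move=> /andP[/eqP e1 /eqP e2]; rewrite [a]surjective_pairing [b]surjective_pairing e1 e2.
(* The coordinate of [c] on the line through [a] and [b], with [a] at 0 and [b] at 1. The point in
   the middle is [a], [c] or [b] according as t < 0, 0 < t < 1 or t > 1. *)
pose t := ((c.1 - a.1) * (b.1 - a.1) + (c.2 - a.2) * (b.2 - a.2)) / N.
have ec1 : c.1 = (1 - t) * a.1 + t * b.1.
  apply: (mulfI N0); rewrite /t.
  transitivity (N * c.1 + (b.2 - a.2) * det3 a b c).
    by rewrite abc0 mulr0 addr0.
  by rewrite /det3; move: N0; rewrite /N => N0; field.
have ec2 : c.2 = (1 - t) * a.2 + t * b.2.
  apply: (mulfI N0); rewrite /t.
  transitivity (N * c.2 - (b.1 - a.1) * det3 a b c).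
    by rewrite abc0 mulr0 subr0.
  by rewrite /det3; move: N0; rewrite /N => N0; field.
have t0 : t != 0.
  apply: contra_neq ac => t0; rewrite [a]surjective_pairing [c]surjective_pairing.
  by rewrite ec1 ec2 t0 subr0 !mul1r !mul0r !addr0.
have t1 : t != 1.
  apply: contra_neq bc => t1; rewrite [b]surjective_pairing [c]surjective_pairing.
  by rewrite ec1 ec2 t1 subrr !mul1r !mul0r !add0r.
have [t_lt0|t_gt0|/eqP] := ltgtP t 0; last by rewrite (negPf t0).
  have s01 : 0 < (1 - t)^-1 < 1.
    by rewrite invr_gt0 subr_gt0 invf_lt1 ?subr_gt0//; lra.
  have [|e _] := va c b _ Pc Pb s01; last by rewrite e eqxx in ac.
  have ? : 1 - t != 0 by rewrite gt_eqF; lra.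
  by rewrite [LHS]surjective_pairing ec1 ec2; congr pair; field.
have [t_lt1|t_gt1|/eqP] := ltgtP t 1; last by rewrite (negPf t1).
  have s01 : 0 < 1 - t < 1 by lra.
  have [|e _] := vc a b _ Pa Pb s01; last by rewrite e eqxx in ac.
  by rewrite [LHS]surjective_pairing ec1 ec2; congr pair; ring.
have s01 : 0 < t^-1 < 1 by rewrite invr_gt0 t_gt0 invf_lt1.
have [|e _] := vb c a _ Pc Pa s01; last by rewrite e eqxx in bc.
by rewrite [LHS]surjective_pairing ec1 ec2; congr pair; field.
Qed.

(** The determinants divided by their sum are barycentric coordinates. They are grouped into [a]
    against a point of the opposite side, since convexity and extremality speak of two points;
    extremality needs [s] strictly between 0 and 1. *)
Lemma in_triangle_conv a b c p : in_triangle a b c p ->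
  exists s r : R, [/\ 0 < s < 1, 0 <= r <= 1 &
    p = (s * a.1 + (1 - s) * (r * b.1 + (1 - r) * c.1),
         s * a.2 + (1 - s) * (r * b.2 + (1 - r) * c.2))].
Proof.
rewrite /in_triangle; set A := det3 p b c; set B := det3 a p c; set C := det3 a b p.
move=> pabc; have S0 : A + B + C != 0.
  by case/orP: pabc => /and3P[? ? ?]; [rewrite gt_eqF|rewrite lt_eqF]; lra.
have BC0 : B + C != 0.
  by case/orP: pabc => /and3P[? ? ?]; [rewrite gt_eqF|rewrite lt_eqF]; lra.
exists (A / (A + B + C)), (B / (B + C)); split.
- case/orP: pabc => /and3P[A0 B0 C0].
    have ? : 0 < A + B + C by lra.
    by rewrite divr_gt0//= ltr_pdivrMr// mul1r; lra.
  have ? : A + B + C < 0 by lra.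
  by rewrite nmulr_lgt0 ?invr_lt0// A0 /= ltr_ndivrMr// mul1r; lra.
- case/orP: pabc => /and3P[A0 B0 C0].
    have s0 : 0 < B + C by lra.
    by rewrite divr_ge0 ?(ltW B0) ?(ltW s0)//= ler_pdivrMr// mul1r; lra.
  have ? : B + C < 0 by lra.
  by rewrite nmulr_lge0 ?invr_lt0// (ltW B0)/= ler_ndivrMr// mul1r; lra.
- rewrite [LHS]surjective_pairing; congr pair => /=;
  by move: S0 BC0; rewrite /A /B /C /det3 => S0 BC0; field; rewrite S0 BC0.
Qed.

Lemma in_triangle_convex (K : set (R * R)) a b c p : convex_set K ->
  K a -> K b -> K c -> in_triangle a b c p -> K p.
Proof.
move=> /convex_setP cK Ka Kb Kc /in_triangle_conv[s [r [/andP[s0 s1] r01 ->]]].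
have Kq := cK _ _ _ Kb Kc r01.
by apply: (cK _ _ _ Ka Kq); rewrite !ltW.
Qed.

Lemma vertices_notin_triangle (P : set (R * R)) a b c p : convex_set P ->
  vertices P a -> vertices P b -> vertices P c -> vertices P p ->
  ~~ in_triangle a b c p.
Proof.
move=> /convex_setP cP /verticesP[Pa _] /verticesP[Pb _] /verticesP[Pc _].
move=> /verticesP[Pp vp]; apply/negP => pabc.
have [s [r [s01 r01 pE]]] := in_triangle_conv pabc.
have [ap _] := vp _ _ _ Pa (cP _ _ _ Pb Pc r01) s01 pE.
move: pabc; rewrite ap /in_triangle /det3; case/orP => /and3P[_];
  by rewrite !subrr mul0r mulr0 subr0 ltxx.
Qed.

(** Induction: a new element [x] is compared with the source [k] of the rest. If [x] precedes [k],
    the absence of cycles of length three makes [x] precede all that [k] precedes. *)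
Lemma acyclic_tournament_source (T : eqType) (r : rel T) (s : seq T) :
  s != [::] -> {in s &, forall j k, j != k -> r j k || r k j} ->
  {in s & &, forall j k l, r j k -> r k l -> ~~ r l j} ->
  exists2 k, k \in s & {in s, forall j, j != k -> r k j}.
Proof.
elim: s => // x s IH _ tot acy; have [->|s0] := eqVneq s [::].
  by exists x; rewrite ?mem_head// => j; rewrite inE => /eqP ->; rewrite eqxx.
have [||k ks kmin] := IH s0.
- by move=> j k js ks; apply: tot; rewrite inE ?js ?ks orbT.
- by move=> j k l js ks ls; apply: acy; rewrite inE ?js ?ks ?ls orbT.
have kxs : k \in x :: s by rewrite inE ks orbT.
have xxs : x \in x :: s by exact: mem_head.
have [xk|xk] := eqVneq x k.
  by exists k => // j; rewrite inE xk => /orP[/eqP->|/kmin//]; rewrite eqxx.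
case/orP: (tot _ _ xxs kxs xk) => rxk; last first.
  by exists k => // j; rewrite inE => /orP[/eqP->|/kmin].
exists x => // j; rewrite inE => /orP[/eqP->|js jx]; first by rewrite eqxx.
have [->//|jk] := eqVneq j k.
have jxs : j \in x :: s by rewrite inE js orbT.
case/orP: (tot _ _ jxs xxs jx) => // rjx.
by have /negP := acy _ _ _ xxs kxs jxs rxk (kmin _ js jk).
Qed.

(** For the converse, the points other than [t_i] are compared by their orientation seen from [t_i].
    General position makes this a tournament, a cycle of three points would enclose [t_i], and a
    source [k] leaves all other points to the left of the line from [t_i] to [t_k], so that [t_i] is
    a vertex of the hull. *)
Lemma convex_positionP n (t : n.-tuple (R * R)) : (2 < n)%N ->
  convex_position t <->
  (forall i j k : 'I_n, uniq [:: i; j; k] ->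
     det3 (tnth t i) (tnth t j) (tnth t k) != 0) /\
  (forall i j k l : 'I_n,
     ~~ in_triangle (tnth t i) (tnth t j) (tnth t k) (tnth t l)).
Proof.
move=> n2; split=> [[ut [P [V _ PE] tE]]|[gp nt]].
  have vt i : vertices P (tnth t i) by rewrite tE /= mem_tnth.
  have cP : convex_set P by rewrite PE; exact: convex_hull_convex.
  have injt : injective (tnth t) by exact/tuple_uniqP.
  split=> [i j k|i j k l]; last exact: vertices_notin_triangle (vt _) (vt _) (vt _) (vt _).
  rewrite /= !inE !negb_or andbT => /andP[/andP[ij ik] jk].
  by apply: vertices_noncollinear (vt i) (vt j) (vt k) _ _ _; rewrite (inj_eq injt).
(* A third index turns general position into distinctness: if two points coincide, their determinant
   with any third point vanishes. *)
have third (i j : 'I_n) : i != j -> exists k, uniq [:: i; j; k].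
  move=> ij; have : ~~ all (mem [:: i; j]) (enum 'I_n).
    apply/negP => /allP /(uniq_leq_size (enum_uniq 'I_n)).
    by rewrite size_enum_ord leqNgt n2.
  move=> /allPn[k _]; rewrite !inE negb_or => /andP[ki kj]; exists k.
  by rewrite /= !inE negb_or ij eq_sym ki eq_sym kj.
have injt : injective (tnth t).
  move=> i j tij; apply/eqP; apply: contraT => /third[k /gp].
  by rewrite tij /det3 !subrr mul0r mulr0 subr0 eqxx.
split; first exact/tuple_uniqP.
exists (convex_hull [set` t]); first by exists [set` t] => //; exact: finite_seq.
apply/seteqP; split=> [|p]; first exact: vertices_convex_hull.
move=> /= /tnthP[i ->].
pose s := [seq j <- enum 'I_n | j != i].
have ms j : (j \in s) = (j != i) by rewrite mem_filter mem_enum andbT.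
have [|j k||k] := @acyclic_tournament_source _
    (fun j k => 0 < det3 (tnth t i) (tnth t j) (tnth t k)) s.
- apply/eqP => s0; have /(uniq_leq_size (enum_uniq 'I_n)) : {subset enum 'I_n <= [:: i]}.
    by move=> j _; apply: contraT; rewrite inE -ms s0.
  by rewrite size_enum_ord leqNgt (ltnW n2).
- rewrite !ms => ji ki jk; rewrite [in X in _ || X]det3C23 oppr_gt0 -neq_lt eq_sym.
  by apply: gp; rewrite /= !inE negb_or ![i == _]eq_sym ji ki jk.
- move=> j k l _ _ _ rjk rkl; apply/negP => rlj.
  have /negP := nt j k l i; apply; rewrite /in_triangle rkl.
  by rewrite det3C12 -det3C23 rlj det3C23 det3C12 opprK rjk.
rewrite ms => ki kmin; apply: (@vertex_of_half_plane _ _ (tnth t k)).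
- by rewrite (inj_eq injt).
- by apply: sub_convex_hull; rewrite /= mem_tnth.
apply: convex_hull_min => [|q /= /tnthP[j ->]]; first exact: convex_half_plane.
have [->|ji] := eqVneq j i; first by right; rewrite /det3 !subrr !mul0r mulr0 subr0 addr0.
have [->|jk] := eqVneq j k.
  by right; split; [rewrite /det3; ring|rewrite -!expr2 addr_ge0 ?sqr_ge0].
by left; apply: kmin; rewrite ?ms.
Qed.

End planar_geometry.

(** * Order types of four and five points *)

Section order_types.
Local Open Scope nat_scope.

Definition mk_triples n : seq (seq nat) :=
  [seq [:: i; q.1; q.2] | i <- iota 0 n,
     q <- [seq q <- allpairs pair (iota 0 n) (iota 0 n) | i < q.1 < q.2]].

Definition others n (s : seq nat) := [seq i <- iota 0 n | i \notin s].

Definition mk_quadruples n : seq (seq nat) :=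
  [seq rcons s i | s <- mk_triples n, i <- others n s].

(** Here the first three indices come in every order, unlike in [mk_quadruples]: repetitions are
    harmless when triangles are forbidden, but a count must meet each triangle once. *)
Definition mk_injections n : seq (seq nat) :=
  [seq s <- [seq i :: s | i <- iota 0 n, s <- [seq [:: i; q.1; q.2] | i <- iota 0 n,
     q <- allpairs pair (iota 0 n) (iota 0 n)]] | uniq s].

(* Precomputed, as the enumeration below evaluates these lists many times. *)
Definition triples4 := Eval vm_compute in mk_triples 4.
Definition triples5 := Eval vm_compute in mk_triples 5.
Definition triples n := if n is 4 then triples4 else triples5.

Definition quadruples4 := Eval vm_compute in mk_quadruples 4.
Definition quadruples5 := Eval vm_compute in mk_quadruples 5.
Definition quadruples n := if n is 4 then quadruples4 else quadruples5.

Definition injections4 := Eval vm_compute in mk_injections 4.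
Definition injections5 := Eval vm_compute in mk_injections 5.
Definition injections n := if n is 4 then injections4 else injections5.

Fixpoint bit_seqs n : seq (seq bool) :=
  if n is n'.+1 then [seq b :: s | b <- [:: true; false], s <- bit_seqs n'] else [:: [::]].

Lemma mem_bit_seqs n s : size s = n -> s \in bit_seqs n.
Proof.
elim: n s => [|n IH] [|b s]//= [/IH sn]; rewrite cats0 mem_cat.
by case: b; rewrite map_f// orbT.
Qed.

Definition look n (b : seq bool) (s : seq nat) := nth false b (index s (triples n)).

(* The alternating extension of the signs [b] of the increasing triples. *)
Definition alternate n (b : seq bool) (i j k : nat) : bool :=
  if i < j then
    if j < k then look n b [:: i; j; k]
    else if i < k then ~~ look n b [:: i; k; j] else look n b [:: k; i; j]
  else if i < k then ~~ look n b [:: j; i; k]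
  else if j < k then look n b [:: j; k; i] else ~~ look n b [:: k; j; i].

(** When no determinant vanishes, [in_triangle] says no more than that the three signs agree. *)
Definition in_triangle_sign (chi : nat -> nat -> nat -> bool) (a b c p : nat) :=
  (chi p b c == chi a p c) && (chi a p c == chi a b p).

(* The sign conditions imposed by det3_affine and det3_plucker. *)
Definition affine_signs (chi : nat -> nat -> nat -> bool) (a b c d : nat) :=
  ~~ [&& chi b c d == ~~ chi a c d, ~~ chi a c d == chi a b d &
         chi a b d == ~~ chi a b c].

Definition plucker_signs (chi : nat -> nat -> nat -> bool) (a b c d e : nat) :=
  ~~ (((chi a b c == chi a d e) == (chi a b d != chi a c e)) &&
      ((chi a b d != chi a c e) == (chi a b e == chi a c d))).

(** The affine condition for each four of the five indices, and the condition on products with each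
    index as base point. These are necessary for signs that come from points, and the enumeration
    shows that they suffice for the count. *)
Definition order_type5 (chi : nat -> nat -> nat -> bool) :=
  [&& affine_signs chi 0 1 2 3, affine_signs chi 0 1 2 4,
   affine_signs chi 0 1 3 4, affine_signs chi 0 2 3 4, affine_signs chi 1 2 3 4,
   plucker_signs chi 0 1 2 3 4, plucker_signs chi 1 0 2 3 4,
   plucker_signs chi 2 0 1 3 4, plucker_signs chi 3 0 1 2 4 &
   plucker_signs chi 4 0 1 2 3].

Implicit Type T : nat -> nat -> nat -> nat -> bool.

Definition no_triangle n T :=
  all (fun s => ~~ T (nth 0 s 0) (nth 0 s 1) (nth 0 s 2) (nth 0 s 3)) (injections n).

Definition count1 n T : nat :=
  sumn [seq (T (nth 0 s 0) (nth 0 s 1) (nth 0 s 2) (nth 0 s 3) : nat) | s <- quadruples n].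

Definition count2 T : nat :=
  sumn [seq (let r := others 5 s in
    T (nth 0 s 0) (nth 0 s 1) (nth 0 s 2) (nth 0 r 0) &&
    T (nth 0 s 0) (nth 0 s 1) (nth 0 s 2) (nth 0 r 1) : nat) | s <- triples 5].

(* With five, four or three extreme points, [count1] is 0, 2 or 4 and [count2] is 0, 0
   or 1; this is checked on all the sign vectors. *)
Lemma order_type5_count (b : seq bool) : size b = 10 ->
  let T := in_triangle_sign (alternate 5 b) in
  order_type5 (alternate 5 b) ->
  2 * no_triangle 5 T + count1 5 T = 2 + 2 * count2 T.
Proof.
move=> /mem_bit_seqs bs T.
suff /allP /(_ b bs) : all (fun b =>
    let T := in_triangle_sign (alternate 5 b) in
    order_type5 (alternate 5 b) ==>
    (2 * no_triangle 5 T + count1 5 T == 2 + 2 * count2 T)) (bit_seqs 10).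
  by move=> /implyP h /h /eqP.
by vm_compute.
Qed.

(** On the sixteen sign vectors, those that pass the affine condition have either no point inside
    the triangle of the others or exactly one. *)
Lemma order_type4_count (b : seq bool) : size b = 4 ->
  let T := in_triangle_sign (alternate 4 b) in
  affine_signs (alternate 4 b) 0 1 2 3 ->
  no_triangle 4 T + count1 4 T = 1.
Proof.
move=> /mem_bit_seqs bs T.
suff /allP /(_ b bs) : all (fun b =>
    let T := in_triangle_sign (alternate 4 b) in
    affine_signs (alternate 4 b) 0 1 2 3 ==>
    (no_triangle 4 T + count1 4 T == 1)) (bit_seqs 4).
  by move=> /implyP h /h /eqP.
by vm_compute.
Qed.

(** [T] is only evaluated at distinct indices below [n], where orientations of points in general
    position have a sign. The conclusion is a pair so that both equations serve in one rewrite. *)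
Lemma eq_no_triangle n T T' : n = 4%N \/ n = 5%N ->
  (forall i j k l, i < n -> j < n -> k < n -> l < n -> uniq [:: i; j; k; l] ->
     T i j k l = T' i j k l) ->
  (no_triangle n T = no_triangle n T') * (count1 n T = count1 n T').
Proof.
move=> n45 TT'.
have {}TT' s : all (fun i => i < n) s && uniq s && (size s == 4) ->
    T (nth 0 s 0) (nth 0 s 1) (nth 0 s 2) (nth 0 s 3) =
    T' (nth 0 s 0) (nth 0 s 1) (nth 0 s 2) (nth 0 s 3).
  case: s => [|i [|j [|k [|l [|? ?]]]]]; rewrite ?andbF// => /andP[/andP[/and5P[? ? ? ? _] u] _].
  exact: TT'.
split.
  apply: eq_in_all => s sn; rewrite TT'//.
  have /allP/(_ s sn)// : all (fun s => all (fun i => i < n) s && uniq s && (size s == 4))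
    (injections n) by case: n45 => ->; vm_compute.
congr sumn; apply/eq_in_map => s sn; rewrite TT'//.
have /allP/(_ s sn)// : all (fun s => all (fun i => i < n) s && uniq s && (size s == 4))
  (quadruples n) by case: n45 => ->; vm_compute.
Qed.

Lemma eq_count2 T T' :
  (forall i j k l, i < 5 -> j < 5 -> k < 5 -> l < 5 -> uniq [:: i; j; k; l] ->
     T i j k l = T' i j k l) ->
  count2 T = count2 T'.
Proof. by move=> TT'; rewrite /count2 /= !TT'. Qed.

End order_types.

(** * Orientation signs of actual points *)

Section order_type_of_points.
Context {R : realType}.
Implicit Types (a b c d e : R * R) (p : nat -> R * R).

(** The 4 by 4 determinant formed by the homogeneous coordinates with the row of ones repeated,
    expanded along the extra row. *)
Lemma det3_affine a b c d :
  det3 b c d - det3 a c d + det3 a b d - det3 a b c = 0.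
Proof. by rewrite /det3; ring. Qed.

(** The three-term Grassmann-Plücker relation between the vectors from [a] to the other four
    points. *)
Lemma det3_plucker a b c d e :
  det3 a b c * det3 a d e - det3 a b d * det3 a c e + det3 a b e * det3 a c d = 0.
Proof. by rewrite /det3; ring. Qed.

Definition chi p (i j k : nat) : bool := 0 < det3 (p i) (p j) (p k).

Definition general_position n p := forall i j k : nat,
  (i < n)%N -> (j < n)%N -> (k < n)%N -> uniq [:: i; j; k] ->
  det3 (p i) (p j) (p k) != 0.

Definition tri p (i j k l : nat) := in_triangle (p i) (p j) (p k) (p l).

Lemma ltNgt0 (x : R) : x != 0 -> (x < 0) = ~~ (0 < x).
Proof. by move=> x0; rewrite -leNgt le_eqVlt (negPf x0). Qed.

Lemma chiC12 n p i j k : general_position n p ->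
  (i < n)%N -> (j < n)%N -> (k < n)%N -> uniq [:: i; j; k] ->
  chi p j i k = ~~ chi p i j k.
Proof. by move=> gp *; rewrite /chi det3C12 oppr_gt0 ltNgt0// gp. Qed.

Lemma chiC23 n p i j k : general_position n p ->
  (i < n)%N -> (j < n)%N -> (k < n)%N -> uniq [:: i; j; k] ->
  chi p i k j = ~~ chi p i j k.
Proof. by move=> gp *; rewrite /chi det3C23 oppr_gt0 ltNgt0// gp. Qed.

Lemma tri_sign n p i j k l : general_position n p ->
  (i < n)%N -> (j < n)%N -> (k < n)%N -> (l < n)%N -> uniq [:: i; j; k; l] ->
  tri p i j k l = in_triangle_sign (chi p) i j k l.
Proof.
move=> gp ? ? ? ?; rewrite /= !inE !negb_or => /and4P[/and3P[ij ik il] /andP[jk jl] kl _].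
rewrite /tri /in_triangle /in_triangle_sign /chi !ltNgt0.
- by case: (0 < _); case: (0 < _); case: (0 < _).
- by apply: gp; rewrite //= !inE negb_or ij il jl.
- by apply: gp; rewrite //= !inE negb_or ik il [l == k]eq_sym kl.
- by apply: gp; rewrite //= !inE negb_or ![l == _]eq_sym jl kl jk.
Qed.

Definition sign_bits n p := [seq chi p (nth 0 s 0) (nth 0 s 1) (nth 0 s 2) | s <- triples n]%N.

Lemma mem_triples n (a b c : nat) : n = 4%N \/ n = 5%N -> (a < b < c)%N -> (c < n)%N ->
  [:: a; b; c] \in triples n.
Proof.
move=> n45 /andP[ab bc] cn.
have bn := ltn_trans bc cn; have an := ltn_trans ab bn.
have /allP/(_ a)/[!mem_iota]/(_ an) : all (fun a : nat => all (fun b : nat => all (fun c : nat =>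
  (a < b < c)%N ==> ([:: a; b; c] \in triples n)) (iota 0 n)) (iota 0 n)) (iota 0 n).
  by case: n45 => ->; vm_compute.
move=> /allP/(_ b)/[!mem_iota]/(_ bn)/allP/(_ c)/[!mem_iota]/(_ cn).
by rewrite ab bc.
Qed.

Lemma alternate_chi n p i j k : n = 4%N \/ n = 5%N -> general_position n p ->
  (i < n)%N -> (j < n)%N -> (k < n)%N -> uniq [:: i; j; k] ->
  chi p i j k = alternate n (sign_bits n p) i j k.
Proof.
move=> n45 gp ni nj nk u.
have lookE (a b c : nat) : (a < b < c)%N -> (c < n)%N ->
    look n (sign_bits n p) [:: a; b; c] = chi p a b c.
  move=> abc cn; have abcn := mem_triples n45 abc cn.
  by rewrite /look /sign_bits (nth_map [::]) ?index_mem// nth_index.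
move: u; rewrite /= !inE negb_or => /andP[/andP[ij ik] /andP[jk _]].
have neq := (negPf ij, negPf ik, negPf jk, eq_sym j i, eq_sym k i, eq_sym k j).
have e12 : chi p j i k = ~~ chi p i j k.
  by apply: (chiC12 gp) => //; rewrite /= !inE !neq.
have e23 : chi p i k j = ~~ chi p i j k.
  by apply: (chiC23 gp) => //; rewrite /= !inE !neq.
have e312 : chi p k i j = chi p i j k.
  by rewrite -[RHS]negbK -e23; apply: (chiC12 gp) => //; rewrite /= !inE !neq.
have e231 : chi p j k i = chi p i j k.
  by rewrite -[RHS]negbK -e12; apply: (chiC23 gp) => //; rewrite /= !inE !neq.
have e321 : chi p k j i = ~~ chi p i j k.
  by rewrite -e312; apply: (chiC23 gp) => //; rewrite /= !inE !neq.
rewrite /alternate; case: (ltngtP i j) ij => // ij _.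
  case: (ltngtP j k) jk => // jk _; first by rewrite lookE ?ij ?jk.
  case: (ltngtP i k) ik => // ik _; rewrite lookE ?ij ?ik ?jk ?e23 ?e312 ?negbK//.
case: (ltngtP i k) ik => // ik _; first by rewrite lookE ?ij ?ik ?e12 ?negbK.
by case: (ltngtP j k) jk => // jk _; rewrite lookE ?ij ?ik ?jk ?e231 ?e321 ?negbK.
Qed.

Lemma gt0_mul_chi (x y : R) : x != 0 -> y != 0 -> (0 < x * y) = ((0 < x) == (0 < y)).
Proof.
move=> x0 y0; case: (ltrP 0 x) => xx; first by rewrite pmulr_rgt0.
have {}xx : x < 0 by rewrite lt_neqAle x0.
by rewrite nmulr_rgt0// (ltNgt0 y0); case: (0 < y).
Qed.

Lemma affine_signs_chi n p (a b c d : nat) : general_position n p ->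
  (a < n)%N -> (b < n)%N -> (c < n)%N -> (d < n)%N -> uniq [:: a; b; c; d] ->
  affine_signs (chi p) a b c d.
Proof.
move=> gp an bn cn dn u; apply/negP.
move: u; rewrite /= !inE !negb_or => /and4P[/and3P[ab ac ad] /andP[bc bd] cd _].
have := det3_affine (p a) (p b) (p c) (p d).
have : det3 (p b) (p c) (p d) != 0 by apply: gp; rewrite //= !inE negb_or bc bd cd.
have : det3 (p a) (p c) (p d) != 0 by apply: gp; rewrite //= !inE negb_or ac ad cd.
have : det3 (p a) (p b) (p d) != 0 by apply: gp; rewrite //= !inE negb_or ab ad bd.
have : det3 (p a) (p b) (p c) != 0 by apply: gp; rewrite //= !inE negb_or ab ac bc.
rewrite /chi.
move: (det3 _ _ _) (det3 _ _ _) (det3 _ _ _) (det3 _ _ _) => x y z t x0 y0 z0 t0.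
have neq := (negPf x0, negPf y0, negPf z0, negPf t0).
move=> e; rewrite -!ltNgt0//.
by have [?|?|/eqP] := ltgtP x 0; rewrite ?neq //;
   have [?|?|/eqP] := ltgtP y 0; rewrite ?neq //;
   have [?|?|/eqP] := ltgtP z 0; rewrite ?neq //;
   have [?|?|/eqP] := ltgtP t 0; rewrite ?neq // => _; lra.
Qed.

Lemma plucker_signs_chi n p (a b c d e : nat) : general_position n p ->
  (a < n)%N -> (b < n)%N -> (c < n)%N -> (d < n)%N -> (e < n)%N ->
  uniq [:: a; b; c; d; e] -> plucker_signs (chi p) a b c d e.
Proof.
move=> gp an bn cn dn en u; rewrite /plucker_signs /chi.
move: u; rewrite /= !inE !negb_or => /and5P[/and4P[ab ac ad ae] /and3P[bc bd be] /andP[cd ce] de _].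
have H i j : (i < n)%N -> (j < n)%N -> a != i -> a != j -> i != j ->
    det3 (p a) (p i) (p j) != 0.
  by move=> ni nj ai aj ij; apply: gp; rewrite //= !inE negb_or ai aj ij.
have := det3_plucker (p a) (p b) (p c) (p d) (p e).
rewrite -!gt0_mul_chi ?H//.
have : det3 (p a) (p b) (p c) * det3 (p a) (p d) (p e) != 0 by rewrite mulf_neq0 ?H.
have : det3 (p a) (p b) (p d) * det3 (p a) (p c) (p e) != 0 by rewrite mulf_neq0 ?H.
have : det3 (p a) (p b) (p e) * det3 (p a) (p c) (p d) != 0 by rewrite mulf_neq0 ?H.
move: (_ * _) (_ * _) (_ * _) => x y z x0 y0 z0 exyz.
have neq := (negPf x0, negPf y0, negPf z0).
by have [?|?|/eqP] := ltgtP x 0; rewrite ?neq //;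
   have [?|?|/eqP] := ltgtP y 0; rewrite ?neq //;
   have [?|?|/eqP] := ltgtP z 0; rewrite ?neq //; lra.
Qed.

Lemma size_sign_bits n p : size (sign_bits n p) = size (triples n).
Proof. by rewrite size_map. Qed.

Lemma eq_alternate_tri n p : n = 4%N \/ n = 5%N -> general_position n p ->
  forall i j k l : nat, (i < n)%N -> (j < n)%N -> (k < n)%N -> (l < n)%N ->
  uniq [:: i; j; k; l] ->
  tri p i j k l = in_triangle_sign (alternate n (sign_bits n p)) i j k l.
Proof.
move=> n45 gp i j k l ni nj nk nl u; rewrite (tri_sign gp)//.
move: u; rewrite /= !inE !negb_or => /and4P[/and3P[ij ik il] /andP[jk jl] kl _].
by rewrite /in_triangle_sign !(alternate_chi n45 gp)//= !inE !negb_or ?[l == _]eq_sym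
  ?ij ?ik ?il ?jk ?jl ?kl.
Qed.

Lemma four_points p : general_position 4 p ->
  (no_triangle 4 (tri p) + count1 4 (tri p) = 1)%N.
Proof.
move=> gp; have n45 : 4 = 4%N \/ 4 = 5%N by left.
rewrite !(eq_no_triangle n45 (eq_alternate_tri n45 gp)).
apply: order_type4_count; first by rewrite size_sign_bits.
by rewrite /affine_signs -!(alternate_chi n45 gp)//; apply: (affine_signs_chi gp).
Qed.

Lemma five_points p : general_position 5 p ->
  (2 * no_triangle 5 (tri p) + count1 5 (tri p) = 2 + 2 * count2 (tri p))%N.
Proof.
move=> gp; have n45 : 5 = 4%N \/ 5 = 5%N by right.
rewrite !(eq_no_triangle n45 (eq_alternate_tri n45 gp)) (eq_count2 (eq_alternate_tri n45 gp)).
apply: order_type5_count; first by rewrite size_sign_bits.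
rewrite /order_type5 /affine_signs /plucker_signs -!(alternate_chi n45 gp)//.
by do ?[apply/andP; split];
  first [exact: (affine_signs_chi gp) | exact: (plucker_signs_chi gp)].
Qed.

(** Each coincidence makes one of the three determinants vanish. This disposes of the repeated
    indices, which [no_triangle] does not visit. *)
Lemma in_triangle_eq (a b c q : R * R) :
  [|| a == b, a == c, b == c, q == a, q == b | q == c] -> in_triangle a b c q = false.
Proof.
by move=> h; apply/negP; move: h; rewrite /in_triangle /det3;
  do ![move=> /orP[/eqP->|]] => [| | | | |/eqP->] /orP[] /and3P[]; lra.
Qed.

Lemma mem_injections n (i j k l : nat) : n = 4%N \/ n = 5%N ->
  (i < n)%N -> (j < n)%N -> (k < n)%N -> (l < n)%N ->
  uniq [:: i; j; k; l] -> [:: i; j; k; l] \in injections n.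
Proof.
move=> n45 ni nj nk nl u.
have /allP/(_ i)/[!mem_iota]/(_ ni) : all (fun i : nat => all (fun j : nat =>
  all (fun k : nat => all (fun l : nat => uniq [:: i; j; k; l] ==>
  ([:: i; j; k; l] \in injections n)) (iota 0 n)) (iota 0 n)) (iota 0 n)) (iota 0 n).
  by case: n45 => ->; vm_compute.
move=> /allP/(_ j)/[!mem_iota]/(_ nj)/allP/(_ k)/[!mem_iota]/(_ nk).
by move=> /allP/(_ l)/[!mem_iota]/(_ nl); rewrite u.
Qed.

Lemma convex_position_no_triangle n (t : n.-tuple (R * R)) : n = 4%N \/ n = 5%N ->
  convex_position t <->
  general_position n (nth 0 t) /\ no_triangle n (tri (nth 0 t)).
Proof.
move=> n45; have n2 : (2 < n)%N by case: n45 => ->.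
rewrite convex_positionP//; split=> -[gp nt]; split.
- move=> i j k ni nj nk u.
  by have := gp (Ordinal ni) (Ordinal nj) (Ordinal nk) u; rewrite !(tnth_nth 0).
- apply/allP => s sn; have : all (fun i => (i < n)%N) s && (size s == 4%N).
    have /allP/(_ s sn)// : all (fun s => all (fun i => (i < n)%N) s && (size s == 4%N))
      (injections n) by case: n45 => ->; vm_compute.
  case: s {sn} => [|i [|j [|k [|l [|? ?]]]]];
    rewrite ?andbF// => /andP[/and5P[ni nj nk nl _] _].
  have := nt (Ordinal ni) (Ordinal nj) (Ordinal nk) (Ordinal nl).
  by rewrite !(tnth_nth 0).
- move=> i j k u; rewrite !(tnth_nth 0); exact: gp.
- move=> i j k l; rewrite !(tnth_nth 0).
  have [u|] := boolP (uniq [:: val i; val j; val k; val l]).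
    exact: (allP nt) (mem_injections n45 (ltn_ord i) (ltn_ord j) (ltn_ord k) (ltn_ord l) u).
  move=> u; rewrite in_triangle_eq//; apply: contraNT u; rewrite !negb_or.
  move=> /and5P[ij ik jk li /andP[lj lk]]; rewrite /= !inE !negb_or.
  do ![apply/andP; split] => //;
    [move: ij|move: ik|move: li|move: jk|move: lj|move: lk];
    apply: contra => /eqP -> //.
Qed.

End order_type_of_points.

(** * Independent samples *)

Section iid.
Local Open Scope ereal_scope.
Context {d : measure_display} {T : measurableType d} {R : realType}.
Variable P : probability T R.

(** The product measure is by definition the integral of the measures of the sections, so [A] may be
    any set. Iterating draws the points one at a time, in the order of the tuple. *)
Lemma iid_lawS n (A : set (n.+1.-tuple T)) :
  iid_law P n.+1 A = \int[P]_x iid_law P n [set t : n.-tuple T | A [tuple of x :: t]].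
Proof.
rewrite /= /distribution /pushforward /= /product_measure1; apply: eq_integral => x _ /=.
by congr (iid_law P n _); apply/seteqP; split=> t /=; rewrite /xsection/= inE.
Qed.

Lemma measurable_box n (B : 'I_n -> set T) : (forall i, measurable (B i)) ->
  measurable [set t : n.-tuple T | forall i, B i (tnth t i)].
Proof.
move=> mB; rewrite (_ : [set t | _] =
    \bigcap_(i in [set: 'I_n]) ((fun t : n.-tuple T => tnth t i) @^-1` B i)).
  apply: fin_bigcap_measurable => // i _.
  by rewrite -[X in measurable X]setTI; exact: measurable_tnth.
by apply/seteqP; split=> [t h i _|t h i]; [exact: h|exact: (h i)].
Qed.

Lemma measurable_reindex n k (f : 'I_k -> 'I_n) :
  measurable_fun [set: n.-tuple T] (fun t => [tuple tnth t (f i) | i < k]).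
Proof.
apply/measurable_fun_tnthP => i; rewrite (_ : _ \o _ = (fun t => tnth t (f i))).
  exact: measurable_tnth.
by apply/funext => t /=; rewrite tnth_mktuple.
Qed.

(** Boxes are closed under intersection and generate the product sigma-algebra. *)
Lemma tuple_measure_unique n (m1 m2 : {measure set (n.-tuple T) -> \bar R}) :
  m1 setT < +oo ->
  (forall B : 'I_n -> set T, (forall i, measurable (B i)) ->
    m1 [set t | forall i, B i (tnth t i)] = m2 [set t | forall i, B i (tnth t i)]) ->
  forall A, measurable A -> m1 A = m2 A.
Proof.
move=> m1oo m12 A mA.
pose boxes := [set [set t : n.-tuple T | forall i, B i (tnth t i)] |
  B in [set B | forall i, measurable (B i)]].
apply: (@measure_unique _ _ _ boxes (fun=> setT)) => //.
- apply/seteqP; split; apply: smallest_sub.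
  + exact: smallest_sigma_algebra.
  + case: n @boxes {A mA m1 m2 m12 m1oo} => [|k] boxes.
      by rewrite big_ord0.
    rewrite -bigcup_mkord_ord => _ [i _ [B mB <-]]; apply: sub_sigma_algebra.
    exists (fun j => if j == inord i then B else setT).
      by move=> j; case: ifP.
    apply/seteqP; split=> [t /(_ (inord i))|t [_ h] j].
      by rewrite eqxx; split.
    by case: eqP => [->|].
  + exact: sigma_algebra_measurable.
  + by move=> _ [B mB <-]; exact: measurable_box.
- move=> _ _ [B mB <-] [C mC <-]; exists (fun i => B i `&` C i).
    by move=> i; exact: measurableI.
  by apply/seteqP; split=> [t h|t [h1 h2] i] /=; [split=> i; case: (h i)|split; [exact: h1|exact: h2]].
- by move=> _; exists (fun=> setT) => //; apply/seteqP; split.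
- by apply/seteqP; split => // t _; exists 0%N.
- by move=> _ [B mB <-]; exact: m12.
Qed.

(** Any subsample with distinct indices is again independent with law [P]. It suffices to test
    boxes, where coordinates outside the image of [f] contribute the factor 1. *)
Lemma iid_law_reindex n k (f : 'I_k -> 'I_n) (A : set (k.-tuple T)) :
  injective f -> measurable A ->
  iid_law P n [set t | A [tuple tnth t (f i) | i < k]] = iid_law P k A.
Proof.
move=> injf mA; apply/esym.
pose phi_mixin := isMeasurableFun.Build _ _ _ _ _ (measurable_reindex f).
pose phi : {mfun _ >-> _} := HB.pack (fun t => [tuple tnth t (f i) | i < k]) phi_mixin.
pose Pn := distribution (iid_law P n) phi.
apply: (tuple_measure_unique (m1 := iid_law P k) (m2 := Pn)) => //.
  by apply: (@le_lt_trans _ _ 1%E); [exact: probability_le1|exact: ltry].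
move=> B mB; transitivity (\prod_(i < k) P (B i)); first exact: iid_lawE.
rewrite -[RHS]/(iid_law P n (phi @^-1` [set t | forall i, B i (tnth t i)])).
(* The sides of the preimage box: [B i] at the coordinate [f i], the whole space at coordinates that
   [f] misses. *)
pose C j := if [pick i | f i == j] is Some i then B i else setT.
have CE i : C (f i) = B i.
  by rewrite /C; case: pickP => [j /eqP/injf->//|/(_ i)]; rewrite eqxx.
rewrite (_ : _ @^-1` _ = [set t | forall j, C j (tnth t j)]); last first.
  apply/seteqP; split=> t h.
    move=> j; rewrite /C; case: pickP => // i /eqP <-.
    by have := h i; rewrite tnth_mktuple.
  by move=> i; rewrite tnth_mktuple -CE; exact: h.
rewrite iid_lawE; last by move=> j; rewrite /C; case: pickP.
rewrite [RHS](bigID (mem (codom f)))/= [X in (_ * X)%E]big1 ?mule1; last first.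
  move=> j jf; rewrite /C; case: pickP => [i /eqP ij|_]; last exact: probability_setT.
  by rewrite -ij codom_f in jf.
transitivity (\prod_(j <- codom f) P (C j)); last first.
  by rewrite big_uniq// map_inj_uniq// enum_uniq.
by rewrite big_image/=; apply: eq_bigr => i _; rewrite CE.
Qed.

End iid.

Section iid_map.
Local Open Scope ereal_scope.
Context {d : measure_display} {T : measurableType d} {R : realType}.

Lemma measurable_map_tuple n (phi : T -> T) : measurable_fun setT phi ->
  measurable_fun [set: n.-tuple T] (fun t => [tuple of map phi t]).
Proof.
move=> mphi; apply/measurable_fun_tnthP => i.
rewrite (_ : _ \o _ = (fun t => phi (tnth t i))).
  by apply: measurableT_comp mphi _; exact: measurable_tnth.
by apply/funext => t /=; rewrite tnth_map.
Qed.

Lemma iid_law_map (P Q : probability T R) (phi : T -> T) n (A : set (n.-tuple T)) :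
  measurable_fun setT phi -> (forall B, measurable B -> Q B = P (phi @^-1` B)) ->
  measurable A -> iid_law Q n A = iid_law P n [set t : n.-tuple T | A [tuple of map phi t]].
Proof.
move=> mphi QP mA.
pose psi : {mfun _ >-> _} := HB.pack (fun t : n.-tuple T => [tuple of map phi t])
  (isMeasurableFun.Build _ _ _ _ _ (measurable_map_tuple (n := n) mphi)).
apply: (tuple_measure_unique (m1 := iid_law Q n) (m2 := distribution (iid_law P n) psi)) => //.
  by apply: (@le_lt_trans _ _ 1%E); [exact: probability_le1|exact: ltry].
move=> B mB; transitivity (\prod_(i < n) Q (B i)); first exact: iid_lawE.
rewrite -[RHS]/(iid_law P n (psi @^-1` [set t | forall i, B i (tnth t i)])).
rewrite (_ : _ @^-1` _ = [set t | forall i, (phi @^-1` B i) (tnth t i)]).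
  rewrite (@iid_lawE _ _ _ P n (fun i => phi @^-1` B i)).
    by apply: eq_bigr => i _; exact: QP.
  by move=> i; rewrite -[X in measurable X]setTI; exact: (mphi measurableT _ (mB i)).
by apply/seteqP; split=> t h i; have := h i; rewrite tnth_map.
Qed.

Lemma iid_law_all (P : probability T R) n (K : set T) : measurable K -> P K = 1 ->
  iid_law P n [set t | forall i, K (tnth t i)] = 1.
Proof. by move=> mK PK; rewrite (iid_lawE P (fun=> mK)) big1. Qed.

End iid_map.

Section measurable_geometry.
Context {R : realType} {d : measure_display} {X : measurableType d}.
Local Notation mR := (measurableTypeR R).
Implicit Types f g h : X -> mR * mR.

Lemma measurable_fst_comp f : measurable_fun setT f -> measurable_fun setT (fun x => (f x).1 : R).
Proof. by move=> mf; apply: measurableT_comp mf => //. Qed.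

Lemma measurable_snd_comp f : measurable_fun setT f -> measurable_fun setT (fun x => (f x).2 : R).
Proof. by move=> mf; apply: measurableT_comp mf => //. Qed.

Lemma measurable_det3 f g h : measurable_fun setT f -> measurable_fun setT g ->
  measurable_fun setT h -> measurable_fun setT (fun x => det3 (f x) (g x) (h x)).
Proof.
by move=> mf mg mh; apply: measurable_funB; apply: measurable_funM;
  apply: measurable_funB; (exact: measurable_fst_comp || exact: measurable_snd_comp).
Qed.

Lemma measurable_in_triangle f g h k : measurable_fun setT f -> measurable_fun setT g ->
  measurable_fun setT h -> measurable_fun setT k ->
  measurable_fun setT (fun x => in_triangle (f x) (g x) (h x) (k x)).
Proof.
by move=> mf mg mh mk; apply: measurable_or; apply: measurable_and;
  rewrite -/(measurable_fun _ _); try apply: measurable_and; apply: measurable_fun_ltr => //;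
  exact: measurable_det3.
Qed.

End measurable_geometry.

(** * Degenerate samples have probability zero *)

Section iid_plane.
Context {R : realType}.
Local Notation mR := (measurableTypeR R).
Variable P : probability (mR * mR)%type R.

Lemma measurable_nth n i :
  measurable_fun [set: n.-tuple (mR * mR)] (fun t => nth (0 : R * R) t i : mR * mR).
Proof.
have [ni|ni] := ltnP i n; last first.
  rewrite (_ : (fun _ => _) = cst (0 : mR * mR))//.
  by apply/funext => t; rewrite nth_default ?size_tuple.
rewrite (_ : (fun _ => _) = (fun t : n.-tuple (mR * mR) => tnth t (Ordinal ni))).
  exact: measurable_tnth.
by apply/funext => t; rewrite (tnth_nth 0).
Qed.

Lemma measurable_bool d (X : measurableType d) (B : X -> bool) :
  measurable_fun setT B -> measurable [set x | B x].
Proof. by move=> /(_ measurableT [set true] I); rewrite setTI. Qed.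

Lemma measurable_eq_cst d (X : measurableType d) (f : X -> R) (c : R) :
  measurable_fun setT f -> measurable [set x | f x = c].
Proof.
move=> mf; rewrite (_ : [set x | _] = [set x | f x == c]).
  by apply: measurable_bool; exact: measurable_fun_eqr.
by apply/seteqP; split=> x /eqP.
Qed.

Lemma iid_law_seq n (s : seq nat) (B : seq (R * R) -> bool) :
  uniq s -> all (fun i => i < n)%N s ->
  measurable [set t : (size s).-tuple (mR * mR) | B t] ->
  iid_law P n [set t | B [seq nth 0 (t : seq (R * R)) i | i <- s]] =
  iid_law P (size s) [set t | B t].
Proof.
move=> us sn mB.
have Hf (m : 'I_(size s)) : (nth 0 s m < n)%N by apply: (allP sn); rewrite mem_nth.
pose f m := Ordinal (Hf m).
have injf : injective f.
  by move=> m m' [] /eqP; rewrite nth_uniq// => /eqP/val_inj.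
rewrite -(iid_law_reindex P injf mB); congr (iid_law P n _); apply: eq_set => t.
congr (is_true (B _)); apply: (@eq_from_nth _ 0) => [|m]; rewrite size_map ?size_tuple// => ms.
rewrite (nth_map 0%N)// (nth_mktuple _ _ (Ordinal ms)) (tnth_nth 0)//.
Qed.

(** Linearity of expectation, for numbers of events written as sums of Booleans as in [count1]. *)
Lemma integral_count d (X : measurableType d) (mu : {measure set X -> \bar R}) I (L : seq I)
    (B : I -> X -> bool) : (forall i, measurable_fun setT (B i)) ->
  (\int[mu]_x ((sumn [seq (B i x : nat) | i <- L])%:R : R)%:E =
   \sum_(i <- L) mu [set x | B i x])%E.
Proof.
move=> mB; transitivity (\int[mu]_x (\sum_(i <- L) (\1_[set x | B i x] x)%:E))%E.
  apply: eq_integral => x _; rewrite sumnE big_map natr_sum -sumEFin.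
  by apply: eq_bigr => i _; rewrite indicE; congr ((nat_of_bool _)%:R%:E); apply/idP/idP; rewrite inE.
rewrite ge0_integral_sum//; last first.
  by move=> i; apply/measurable_EFinP; exact: measurable_indic (measurable_bool (mB i)).
by apply: eq_bigr => i _; rewrite integral_indic ?setIT//; exact: measurable_bool.
Qed.

Lemma measurable_count d (X : measurableType d) I (L : seq I)
    (B : I -> X -> bool) : (forall i, measurable_fun setT (B i)) ->
  measurable_fun setT (fun x => ((sumn [seq (B i x : nat) | i <- L])%:R : R)%:E).
Proof.
move=> mB; apply/measurable_EFinP.
rewrite (_ : (fun _ => _) = (fun x => \sum_(i <- L) \1_[set x | B i x] x)); last first.
  apply/funext => x; rewrite sumnE big_map natr_sum.
  by apply: eq_bigr => i _; rewrite indicE; congr ((nat_of_bool _)%:R); apply/idP/idP; rewrite inE.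
by apply: measurable_sum => i; exact: measurable_indic (measurable_bool (mB i)).
Qed.

Lemma measurable_tri n i j k l :
  measurable_fun [set: n.-tuple (mR * mR)] (fun t => tri (nth 0 (t : seq (R * R))) i j k l).
Proof. by apply: measurable_in_triangle; exact: measurable_nth. Qed.

Definition left_of (t : seq (R * R)) i j : bool := (nth 0 t i).1 < (nth 0 t j).1.

Lemma measurable_left_of n i j :
  measurable_fun [set: n.-tuple (mR * mR)] (fun t => left_of t i j).
Proof.
by apply: measurable_fun_ltr; apply: measurable_fst_comp; exact: measurable_nth.
Qed.

Lemma iid_law1 (A : set (mR * mR)) : measurable A ->
  iid_law P 1 [set t | A (nth (0 : R * R) t 0)] = P A.
Proof.
move=> mA; transitivity (iid_law P 1 [set t | forall i : 'I_1, A (tnth t i)]).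
  congr (iid_law P 1 _); apply/seteqP; split=> t h.
    by move=> i; rewrite (tnth_nth 0) ord1; exact: h.
  by have := h ord0; rewrite (tnth_nth 0).
by rewrite (iid_lawE P (fun=> mA)) big_ord1.
Qed.

Lemma iid_law2 (A : set (mR * mR)) : measurable A ->
  iid_law P 2 [set t | A (nth (0 : R * R) t 0) /\ A (nth (0 : R * R) t 1)] = (P A * P A)%E.
Proof.
move=> mA; transitivity (iid_law P 2 [set t | forall i : 'I_2, A (tnth t i)]).
  congr (iid_law P 2 _); apply/seteqP; split=> t h.
    by move=> i; rewrite (tnth_nth 0); case: i => [[|[|]]]//= _; case: h.
  by split; [have := h ord0|have := h (lift ord0 ord0)]; rewrite (tnth_nth 0).
by rewrite (iid_lawE P (fun=> mA)) big_ord_recl big_ord1.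
Qed.

Hypothesis P_vertical : forall r : R, P [set p | p.1 = r] = 0%E.
Hypothesis P_line : forall a b : R * R, a.1 != b.1 -> P [set p | det3 a b p = 0] = 0%E.

Lemma iid_ae_seq n (s : seq nat) (B : seq (R * R) -> bool) :
  uniq s -> all (fun i => i < n)%N s ->
  measurable_fun [set: n.-tuple (mR * mR)] (fun t => B [seq nth 0 (t : seq (R * R)) i | i <- s]) ->
  measurable_fun [set: (size s).-tuple (mR * mR)] (fun t => B t) ->
  iid_law P (size s) [set t | B t] = 0%E ->
  {ae iid_law P n, forall t : n.-tuple (mR * mR),
     ~~ B [seq nth 0 (t : seq (R * R)) i | i <- s]}.
Proof.
move=> us sn mBs mB B0.
exists [set t : n.-tuple (mR * mR) | B [seq nth 0 (t : seq (R * R)) i | i <- s]]; split.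
- exact: measurable_bool.
- by have := iid_law_seq us sn (measurable_bool mB); rewrite B0.
- by move=> t /= /negP; rewrite negbK.
Qed.

Lemma iid_ae_ne_fst n i j : (i < n)%N -> (j < n)%N -> i != j ->
  {ae iid_law P n, forall t : n.-tuple (mR * mR),
    (nth (0 : R * R) t i).1 != (nth (0 : R * R) t j).1}.
Proof.
move=> ni nj ij.
pose B (s : seq (R * R)) := (nth 0 s 0%N).1 == (nth 0 s 1%N).1.
apply: (@iid_ae_seq n [:: i; j] B); rewrite /= ?inE ?ij ?ni ?nj//.
- by apply: measurable_fun_eqr; apply: measurable_fst_comp; exact: measurable_nth.
- by apply: measurable_fun_eqr; apply: measurable_fst_comp; exact: measurable_nth.
change (iid_law P 2 [set t | B t] = 0%E).
rewrite iid_lawS; apply: integral0_eq => a _.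
rewrite -[RHS](P_vertical a.1) -iid_law1; last first.
  by apply: measurable_eq_cst; exact: measurable_fst_comp.
rewrite /B /=; congr (iid_law P 1 _).
by apply/seteqP; split=> [t /eqP e|t e]; [exact: esym e|apply/eqP; exact: esym e].
Qed.

(** Given two points with distinct abscissas, the third one falls on their line with probability
    zero. The condition on abscissas is built into [B] because [P_line] concerns nonvertical lines;
    it holds almost surely by [iid_ae_ne_fst]. *)
Lemma iid_ae_det3 n i j k : (i < n)%N -> (j < n)%N -> (k < n)%N -> uniq [:: i; j; k] ->
  {ae iid_law P n, forall t : n.-tuple (mR * mR),
    det3 (nth 0 t i) (nth 0 t j) (nth 0 t k) != 0}.
Proof.
move=> ni nj nk u.
pose B (s : seq (R * R)) := ((nth 0 s 0%N).1 != (nth 0 s 1%N).1) &&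
  (det3 (nth 0 s 0%N) (nth 0 s 1%N) (nth 0 s 2%N) == 0).
have ij : i != j by move: u; rewrite /= !inE negb_or => /andP[/andP[]].
suff : {ae iid_law P n, forall t : n.-tuple (mR * mR),
     ~~ B [seq nth 0 (t : seq (R * R)) i | i <- [:: i; j; k]]}.
  apply: filterS2 (iid_ae_ne_fst ni nj ij) => t /= tij.
  by rewrite /B /= tij.
apply: iid_ae_seq => //=; first by rewrite ni nj nk.
- apply: measurable_and; first apply: measurable_neg; apply: measurable_fun_eqr => //.
  + by apply: measurable_fst_comp; exact: measurable_nth.
  + by apply: measurable_fst_comp; exact: measurable_nth.
  + by apply: measurable_det3; exact: measurable_nth.
- apply: measurable_and; first apply: measurable_neg; apply: measurable_fun_eqr => //.
  + by apply: measurable_fst_comp; exact: measurable_nth.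
  + by apply: measurable_fst_comp; exact: measurable_nth.
  + by apply: measurable_det3; exact: measurable_nth.
change (iid_law P 3 [set t | B t] = 0%E).
rewrite iid_lawS; apply: integral0_eq => a _.
rewrite iid_lawS; apply: integral0_eq => b _.
have [ab|ab] := eqVneq a.1 b.1.
  rewrite [X in iid_law P 1 X](_ : _ = set0) ?measure0//.
  by apply/seteqP; split=> t //; rewrite /B/= ab eqxx.
rewrite -[RHS](P_line ab) -iid_law1; last first.
  by apply: measurable_eq_cst; exact: measurable_det3.
rewrite /B /= ab /=; congr (iid_law P 1 _).
by apply/seteqP; split=> [t /eqP e|t e]; [exact: e|apply/eqP; exact: e].
Qed.

Lemma iid_ae_general_position n :
  {ae iid_law P n, forall t : n.-tuple (mR * mR), general_position n (nth 0 t)}.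
Proof.
apply: ae_foralln => i; apply: ae_foralln => j; apply: ae_foralln => k.
have [ni|ni] := ltnP i n; last by apply: aeW.
have [nj|nj] := ltnP j n; last by apply: aeW.
have [nk|nk] := ltnP k n; last by apply: aeW.
have [u|u] := boolP (uniq [:: i; j; k]); last by apply: aeW.
by apply: filterS (iid_ae_det3 ni nj nk u).
Qed.

End iid_plane.

(** * Convex position of random points *)

Section convex_position_law.
Context {R : realType}.
Local Notation mR := (measurableTypeR R).

(** Double counting: a combinatorial identity valid for almost every sample becomes an identity
    between sums of probabilities. *)
Lemma ae_eq_count d (X : measurableType d) (mu : {measure set X -> \bar R}) I J
    (L : seq I) (K : seq J) (B : I -> X -> bool) (C : J -> X -> bool) :
  (forall i, measurable_fun setT (B i)) -> (forall j, measurable_fun setT (C j)) ->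
  {ae mu, forall x, sumn [seq (B i x : nat) | i <- L] = sumn [seq (C j x : nat) | j <- K]} ->
  (\sum_(i <- L) mu [set x | B i x] = \sum_(j <- K) mu [set x | C j x])%E.
Proof.
move=> mB mC BC; rewrite -!integral_count//; apply: ge0_ae_eq_integral => //.
- exact: measurable_count.
- exact: measurable_count.
- by apply: filterS BC => x -> _.
Qed.

Lemma in_triangleC12 (a b c p : R * R) : in_triangle b a c p = in_triangle a b c p.
Proof.
rewrite /in_triangle.
have -> : det3 p a c = - det3 a p c by rewrite /det3; ring.
have -> : det3 b p c = - det3 p b c by rewrite /det3; ring.
have -> : det3 b a p = - det3 a b p by rewrite /det3; ring.
by rewrite !oppr_gt0 !oppr_lt0 orbC; congr orb; rewrite andbCA.
Qed.

Lemma in_triangleC23 (a b c p : R * R) : in_triangle a c b p = in_triangle a b c p.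
Proof.
rewrite /in_triangle.
have -> : det3 p c b = - det3 p b c by rewrite /det3; ring.
have -> : det3 a p b = - det3 a b p by rewrite /det3; ring.
have -> : det3 a c p = - det3 a p c by rewrite /det3; ring.
by rewrite !oppr_gt0 !oppr_lt0 orbC; congr orb; rewrite [X in _ && X]andbC.
Qed.

Lemma in_triangle_perm (a b c p : R * R) :
  (in_triangle a c b p = in_triangle a b c p) * (in_triangle b a c p = in_triangle a b c p) *
  (in_triangle b c a p = in_triangle a b c p) * (in_triangle c a b p = in_triangle a b c p) *
  (in_triangle c b a p = in_triangle a b c p).
Proof.
do ![split].
- exact: in_triangleC23.
- exact: in_triangleC12.
- by rewrite in_triangleC23 in_triangleC12.
- by rewrite in_triangleC12 in_triangleC23.
- by rewrite in_triangleC12 in_triangleC23 in_triangleC12.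
Qed.

(* The middle vertex is drawn last, as it is integrated first below. *)
Definition sorted3 (s : seq (R * R)) : bool := left_of s 0 2 && left_of s 2 1.

Definition tri_sorted (s : seq (R * R)) : bool := tri (nth 0 s) 0 2 1 3 && sorted3 s.

Definition tri2_sorted (s : seq (R * R)) : bool :=
  [&& tri (nth 0 s) 0 2 1 3, tri (nth 0 s) 0 2 1 4 & sorted3 s].

Definition orders (i j k : nat) (s : seq nat) : seq (seq nat) :=
  [:: [:: i, j, k & s]; [:: i, k, j & s]; [:: j, i, k & s]; [:: j, k, i & s];
      [:: k, i, j & s]; [:: k, j, i & s]].

(** Three distinct abscissas are sorted by exactly one of the six orders, so at most one term of the
    sum is nonzero. *)
Lemma sorted3_count (t : seq (R * R)) i j k s (x : bool) :
  (nth 0 t i).1 != (nth 0 t j).1 -> (nth 0 t i).1 != (nth 0 t k).1 ->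
  (nth 0 t j).1 != (nth 0 t k).1 ->
  sumn [seq (x && sorted3 [seq nth 0 t m | m <- r] : nat) | r <- orders i j k s] = x.
Proof.
case: x; rewrite /= /sorted3 /left_of //=.
move: (nth 0 t i).1 (nth 0 t j).1 (nth 0 t k).1 => x y z xy xz yz.
have neq := (negPf xy, negPf xz, negPf yz).
have [?|?|/eqP] := ltgtP x y; rewrite ?neq //;
have [?|?|/eqP] := ltgtP x z; rewrite ?neq //;
have [?|?|/eqP] := ltgtP y z; rewrite ?neq //=; exfalso; lra.
Qed.

Variable P : probability (mR * mR)%type R.
Hypothesis P_vertical : forall r : R, P [set p | p.1 = r] = 0%E.
Hypothesis P_line : forall a b : R * R, a.1 != b.1 -> P [set p | det3 a b p = 0] = 0%E.

(** A sixth of the probability that a fourth point falls into the triangle of three others, and in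
    [beta] that two further points do: fixing the order of the abscissas keeps one of six equally
    likely cases ([iid_tri], [iid_tri2]). *)
Definition alpha : \bar R := iid_law P 4 [set t | tri_sorted t].
Definition beta : \bar R := iid_law P 5 [set t | tri2_sorted t].

Lemma measurable_sorted3 n (s : seq nat) : (2 < size s)%N ->
  measurable_fun [set: n.-tuple (mR * mR)]
    (fun t => sorted3 [seq nth 0 (t : seq (R * R)) i | i <- s]).
Proof.
case: s => [|i [|j [|k s]]]// _.
by apply: measurable_and; [exact: (measurable_left_of i k)|exact: (measurable_left_of k j)].
Qed.

Lemma measurable_tri_sorted n (s : seq nat) : (3 < size s)%N ->
  measurable_fun [set: n.-tuple (mR * mR)]
    (fun t => tri_sorted [seq nth 0 (t : seq (R * R)) i | i <- s]).
Proof.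
case: s => [|i [|j [|k [|l s]]]]// _.
apply: measurable_and; last exact: (@measurable_sorted3 _ [:: i, j, k, l & s]).
exact: (measurable_tri i k j l).
Qed.

Lemma measurable_tri2_sorted n (s : seq nat) : (4 < size s)%N ->
  measurable_fun [set: n.-tuple (mR * mR)]
    (fun t => tri2_sorted [seq nth 0 (t : seq (R * R)) i | i <- s]).
Proof.
case: s => [|i [|j [|k [|l [|m s]]]]]// _.
apply: measurable_and; first exact: (measurable_tri i k j l).
apply: measurable_and; last exact: (@measurable_sorted3 _ [:: i, j, k, l, m & s]).
exact: (measurable_tri i k j m).
Qed.

Lemma map_nth_tuple n (t : n.-tuple (mR * mR)) :
  [seq nth (0 : R * R) t i | i <- iota 0 n] = t.
Proof. by rewrite -{2}(size_tuple t); exact: mkseq_nth. Qed.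

Lemma iid_tri_sorted n (s : seq nat) : uniq s -> all (fun i => i < n)%N s -> size s = 4%N ->
  iid_law P n [set t | tri_sorted [seq nth 0 (t : seq (R * R)) i | i <- s]] = alpha.
Proof.
move=> us sn s4; rewrite (@iid_law_seq _ P n s tri_sorted)//; first by rewrite s4.
apply: measurable_bool; rewrite s4.
under eq_fun do rewrite -map_nth_tuple.
exact: (@measurable_tri_sorted 4 (iota 0 4)).
Qed.

Lemma iid_tri2_sorted n (s : seq nat) : uniq s -> all (fun i => i < n)%N s -> size s = 5%N ->
  iid_law P n [set t | tri2_sorted [seq nth 0 (t : seq (R * R)) i | i <- s]] = beta.
Proof.
move=> us sn s5; rewrite (@iid_law_seq _ P n s tri2_sorted)//; first by rewrite s5.
apply: measurable_bool; rewrite s5.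
under eq_fun do rewrite -map_nth_tuple.
exact: (@measurable_tri2_sorted 5 (iota 0 5)).
Qed.

Lemma iid_tri n i j k l : uniq [:: i; j; k; l] -> all (fun i => i < n)%N [:: i; j; k; l] ->
  iid_law P n [set t | tri (nth 0 (t : seq (R * R))) i j k l] = (6%:E * alpha)%E.
Proof.
move=> u ijkl; have := u; rewrite /= !inE !negb_or => /and4P[/and3P[ij ik il] /andP[jk jl] kl _].
have /and5P[ni nj nk nl _] := ijkl.
(* [ae_eq_count] asks for measurability at every index, so sequences of a wrong length receive a
   constant. *)
pose B s (t : n.-tuple (mR * mR)) :=
  if size s == 4%N then tri_sorted [seq nth 0 (t : seq (R * R)) m | m <- s] else true.
have mB s : measurable_fun setT (B s).
  by rewrite /B; case: eqP => // s4; apply: measurable_tri_sorted; rewrite s4.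
have := @ae_eq_count _ _ (iid_law P n) unit (seq nat) [:: tt] (orders i j k [:: l])
  (fun _ t => tri (nth 0 (t : seq (R * R))) i j k l) B
  (fun _ => measurable_tri i j k l) mB.
rewrite big_seq1 => ->.
  rewrite (eq_big_seq (fun=> alpha)).
    by rewrite !big_cons big_nil adde0 mule_natl.
  move=> s sL; have s4 : size s = 4%N.
    by apply/eqP; move: s sL; apply/allP.
  rewrite /B s4 eqxx; apply: iid_tri_sorted => //.
  - have neq := (negPf ij, negPf ik, negPf il, negPf jk, negPf jl, negPf kl,
      eq_sym j i, eq_sym k i, eq_sym k j).
    by move: sL; rewrite !inE; do 5 ?[case/orP]; move/eqP => ->; rewrite /= !inE !neq.
  - by move: sL; rewrite !inE; do 5 ?[case/orP]; move/eqP => ->; rewrite /= ?ni ?nj ?nk ?nl.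
have h1 := iid_ae_ne_fst P_vertical ni nj ij.
have h2 := iid_ae_ne_fst P_vertical ni nk ik.
have h3 := iid_ae_ne_fst P_vertical nj nk jk.
apply: filterS3 h1 h2 h3 => t h1 h2 h3.
rewrite -(@sorted3_count t i j k [:: l] _ h1 h2 h3) /B /= /tri_sorted /tri /= addn0.
by rewrite !(in_triangle_perm (nth 0 t i) (nth 0 t j) (nth 0 t k) (nth 0 t l)).
Qed.

Lemma iid_tri2 n i j k l m : uniq [:: i; j; k; l; m] ->
  all (fun i => i < n)%N [:: i; j; k; l; m] ->
  iid_law P n [set t | tri (nth 0 (t : seq (R * R))) i j k l &&
                       tri (nth 0 (t : seq (R * R))) i j k m] = (6%:E * beta)%E.
Proof.
move=> u ijkl; have := u; rewrite /= !inE !negb_or.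
move=> /and5P[/and4P[ij ik il im] /and3P[jk jl jm] /andP[kl km] lm _].
have := ijkl => /= /and5P[ni nj nk nl /andP[nm _]].
pose B s (t : n.-tuple (mR * mR)) :=
  if size s == 5%N then tri2_sorted [seq nth 0 (t : seq (R * R)) m | m <- s] else true.
have mB s : measurable_fun setT (B s).
  by rewrite /B; case: eqP => // s5; apply: measurable_tri2_sorted; rewrite s5.
have := @ae_eq_count _ _ (iid_law P n) unit (seq nat) [:: tt] (orders i j k [:: l; m])
  (fun _ t => tri (nth 0 (t : seq (R * R))) i j k l &&
              tri (nth 0 (t : seq (R * R))) i j k m) B
  (fun _ => measurable_and (measurable_tri i j k l) (measurable_tri i j k m)) mB.
rewrite big_seq1 => ->.
  rewrite (eq_big_seq (fun=> beta)).
    by rewrite !big_cons big_nil adde0 mule_natl.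
  move=> s sL; have s5 : size s = 5%N.
    by apply/eqP; move: s sL; apply/allP.
  rewrite /B s5 eqxx; apply: iid_tri2_sorted => //.
  - have neq := (negPf ij, negPf ik, negPf il, negPf jk, negPf jl, negPf kl,
      negPf im, negPf jm, negPf km, negPf lm, eq_sym j i, eq_sym k i, eq_sym k j).
    by move: sL; rewrite !inE; do 5 ?[case/orP]; move/eqP => ->; rewrite /= !inE !neq.
  - by move: sL; rewrite !inE; do 5 ?[case/orP]; move/eqP => ->;
      rewrite /= ?ni ?nj ?nk ?nl ?nm.
have h1 := iid_ae_ne_fst P_vertical ni nj ij.
have h2 := iid_ae_ne_fst P_vertical ni nk ik.
have h3 := iid_ae_ne_fst P_vertical nj nk jk.
apply: filterS3 h1 h2 h3 => t h1 h2 h3.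
rewrite -(@sorted3_count t i j k [:: l; m] _ h1 h2 h3) /B /= /tri2_sorted /tri /= addn0.
rewrite !andbA.
by rewrite !(in_triangle_perm (nth 0 t i) (nth 0 t j) (nth 0 t k)).
Qed.

Lemma measurable_convex_position n : n = 4%N \/ n = 5%N ->
  measurable [set t : n.-tuple (mR * mR) | convex_position t].
Proof.
move=> n45; rewrite (_ : [set t | _] =
  [set t : n.-tuple (mR * mR) | forall i j k : 'I_n, uniq [:: i; j; k] ->
     det3 (nth 0 t i) (nth 0 t j) (nth 0 t k) != 0] `&`
  [set t | no_triangle n (tri (nth 0 t))]); last first.
  apply/seteqP; split=> t /=; rewrite convex_position_no_triangle//.
    by move=> [gp nt]; split=> // i j k u; apply: gp.
  move=> [gp nt]; split=> // i j k ni nj nk u.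
  exact: (gp (Ordinal ni) (Ordinal nj) (Ordinal nk) u).
apply: measurableI.
  rewrite (_ : [set t | _] = \bigcap_(i in [set: 'I_n]) \bigcap_(j in [set: 'I_n])
     \bigcap_(k in [set: 'I_n]) [set t : n.-tuple (mR * mR) | uniq [:: i; j; k] ==>
     (det3 (nth 0 t i) (nth 0 t j) (nth 0 t k) != 0)]); last first.
    apply/seteqP; split=> [t h i _ j _ k _|t h i j k u].
      by apply/implyP; exact: h.
    by have /implyP := h i I j I k I; apply.
  do 3 ![apply: fin_bigcap_measurable => // ? _].
  case: uniq => /=; last first.
    by rewrite (_ : [set t | _] = setT)//; apply/seteqP; split.
  apply: measurable_bool; apply: measurable_neg; apply: measurable_fun_eqr => //.
  by apply: measurable_det3; exact: measurable_nth.
apply: measurable_bool; rewrite /no_triangle; elim: injections => //= s L IH.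
by apply: measurable_and => //; apply: measurable_neg; exact: measurable_tri.
Qed.

Lemma iid_convex_position n : n = 4%N \/ n = 5%N ->
  iid_law P n [set t | convex_position t] =
  iid_law P n [set t | no_triangle n (tri (nth 0 (t : seq (R * R))))].
Proof.
move=> n45; pose B (t : n.-tuple (mR * mR)) := `[< convex_position t >].
have mB : measurable_fun setT B.
  apply: (measurable_fun_bool true); rewrite setTI.
  rewrite (_ : _ @^-1` _ = [set t | convex_position t]); first exact: measurable_convex_position.
  by apply/seteqP; split=> t /= /asboolP.
have mC : measurable_fun [set: n.-tuple (mR * mR)]
    (fun t => no_triangle n (tri (nth 0 (t : seq (R * R))))).
  rewrite /no_triangle; elim: injections => //= s L IH.
  by apply: measurable_and => //; apply: measurable_neg; exact: measurable_tri.
have := @ae_eq_count _ _ (iid_law P n) unit unit [:: tt] [:: tt] (fun=> B) _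
  (fun=> mB) (fun=> mC); rewrite !big_seq1 => <-.
  by congr (iid_law P n _); apply/seteqP; split=> t /= /asboolP.
apply: filterS (iid_ae_general_position P_vertical P_line n) => t gp /=.
congr (nat_of_bool _ + _); apply/asboolP/idP; rewrite convex_position_no_triangle//.
by case.
Qed.

Lemma measurable_no_triangle n m :
  measurable_fun [set: n.-tuple (mR * mR)]
    (fun t => no_triangle m (tri (nth 0 (t : seq (R * R))))).
Proof.
rewrite /no_triangle; elim: injections => //= s L IH.
by apply: measurable_and => //; apply: measurable_neg; exact: measurable_tri.
Qed.

Lemma probability_fin d (X : measurableType d) (mu : probability X R) (A : set X) :
  measurable A -> exists a : R, mu A = a%:E.
Proof. by move=> mA; exists (fine (mu A)); rewrite fineK// fin_num_measure. Qed.

Lemma probability_true d (X : measurableType d) (mu : probability X R) :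
  mu [set x | true] = 1%E.
Proof.
by rewrite -(@probability_setT _ _ _ mu); congr (mu _); apply/seteqP; split.
Qed.

(** The option type adds one event to those indexed by [L]; listing [None] twice gives that event
    the coefficient 2 of [five_points]. *)
Lemma sum_None2 I (F : option I -> \bar R) (L : seq I) :
  (\sum_(i <- None :: None :: map Some L) F i =
   F None + (F None + \sum_(s <- L) F (Some s)))%E.
Proof. by rewrite !big_cons big_map. Qed.

Lemma sumn_None2 I (F : option I -> nat) (L : seq I) :
  sumn [seq F i | i <- None :: None :: map Some L] =
  (F None + (F None + sumn [seq F (Some s) | s <- L]))%N.
Proof. by rewrite /= -map_comp. Qed.

Lemma sum_eq_const (L : seq (seq nat)) (F : seq nat -> \bar R) (v : R) :
  {in L, forall s, F s = v%:E} -> (\sum_(s <- L) F s = ((size L)%:R * v)%:E)%E.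
Proof.
move=> Fv; rewrite (eq_big_seq (fun=> v%:E))//; elim: L {Fv} => [|s L IH].
  by rewrite big_nil mul0r.
by rewrite big_cons IH -EFinD; congr EFin; rewrite /= -natr1; ring.
Qed.

Lemma alpha_fin : exists a : R, alpha = a%:E.
Proof.
apply: probability_fin; apply: measurable_bool.
under eq_fun do rewrite -map_nth_tuple.
exact: (@measurable_tri_sorted 4 (iota 0 4)).
Qed.

Lemma beta_fin : exists b : R, beta = b%:E.
Proof.
apply: probability_fin; apply: measurable_bool.
under eq_fun do rewrite -map_nth_tuple.
exact: (@measurable_tri2_sorted 5 (iota 0 5)).
Qed.

(** The expectation of [four_points]: 24 is the number 4 of choices of the inner point times the 6
    of [iid_tri]. *)
Lemma convex_position4 :
  (iid_law P 4 [set t | convex_position t] + 24%:E * alpha = 1)%E.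
Proof.
rewrite iid_convex_position; last by left.
pose B (s : option (seq nat)) (t : 4.-tuple (mR * mR)) :=
  let T := tri (nth 0 (t : seq (R * R))) in
  if s is Some s then T (nth 0 s 0) (nth 0 s 1) (nth 0 s 2) (nth 0 s 3)
  else no_triangle 4 T.
have mB s : measurable_fun setT (B s).
  by case: s => [s|]; [exact: measurable_tri|exact: measurable_no_triangle].
have := @ae_eq_count _ _ (iid_law P 4) _ unit (None :: map Some (quadruples 4)) [:: tt]
  B (fun _ _ => true) mB (fun=> measurable_cst _).
rewrite big_cons big_map big_seq1.
rewrite (eq_big_seq (fun=> (6%:E * alpha)%E)); last first.
  move=> s sq; apply: iid_tri; by move: s sq; apply/allP.
rewrite !big_cons big_nil adde0 => e.
have [a ea] := alpha_fin; transitivity (iid_law P 4 [set t | true]); last exact: probability_true.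
rewrite -e; first by rewrite ea -!EFinM -!EFinD; congr (_ + _%:E)%E; ring.
apply: filterS (iid_ae_general_position P_vertical P_line 4) => t gp.
exact: (four_points gp).
Qed.

(** The expectation of [five_points]: on the left 120 is 6 times the 20 pairs of a triangle and a
    point, on the right it is 2 times 6 times the 10 triangles. *)
Lemma convex_position5 :
  (2%:E * iid_law P 5 [set t | convex_position t] + 120%:E * alpha = 2%:E + 120%:E * beta)%E.
Proof.
rewrite iid_convex_position; last by right.
pose B (s : option (seq nat)) (t : 5.-tuple (mR * mR)) :=
  let T := tri (nth 0 (t : seq (R * R))) in
  if s is Some s then T (nth 0 s 0) (nth 0 s 1) (nth 0 s 2) (nth 0 s 3)
  else no_triangle 5 T.
pose C (s : option (seq nat)) (t : 5.-tuple (mR * mR)) :=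
  let T := tri (nth 0 (t : seq (R * R))) in
  if s is Some s then let r := others 5 s in
    T (nth 0 s 0) (nth 0 s 1) (nth 0 s 2) (nth 0 r 0) &&
    T (nth 0 s 0) (nth 0 s 1) (nth 0 s 2) (nth 0 r 1)
  else true.
have mB s : measurable_fun setT (B s).
  by case: s => [s|]; [exact: measurable_tri|exact: measurable_no_triangle].
have mC s : measurable_fun setT (C s).
  case: s => [s|]; last exact: measurable_cst.
  by apply: measurable_and; exact: measurable_tri.
have h := @ae_eq_count _ _ (iid_law P 5) _ _ (None :: None :: map Some (quadruples 5))
  (None :: None :: map Some (triples 5 ++ triples 5)) B C mB mC.
rewrite !sum_None2 big_cat in h.
have [a ea] := alpha_fin; have [b eb] := beta_fin.
have [c ec] := probability_fin (iid_law P 5) (measurable_bool (@measurable_no_triangle 5 5)).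
have eB : (\sum_(s <- quadruples 5) iid_law P 5 [set x | B (Some s) x] =
    (20%:R * (6 * a))%:E)%E.
  apply: (sum_eq_const (L := quadruples 5)) => s sq.
  by rewrite EFinM -ea; apply: iid_tri; move: s sq; apply/allP.
have eC : (\sum_(s <- triples 5) iid_law P 5 [set x | C (Some s) x] =
    (10%:R * (6 * b))%:E)%E.
  apply: (sum_eq_const (L := triples 5)) => s sq.
  by rewrite EFinM -eb; apply: iid_tri2; move: s sq; apply/allP.
have e1 : iid_law P 5 [set x | C None x] = 1%E by exact: probability_true.
have e0 : iid_law P 5 [set x | B None x] = c%:E by exact: ec.
suff e : (c%:E + (c%:E + (20%:R * (6 * a))%:E) =
    1 + (1 + ((10%:R * (6 * b))%:E + (10%:R * (6 * b))%:E)))%E.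
  by move: e; rewrite ec ea eb -!EFinM -!EFinD => -[e]; congr EFin; lra.
rewrite -e0 -eB -eC -e1; apply: h.
apply: filterS (iid_ae_general_position P_vertical P_line 5) => t gp.
rewrite !sumn_None2 map_cat sumn_cat.
have := five_points gp; rewrite mul2n -addnn -addnA => e; apply: (etrans e).
by rewrite mul2n -addnn.
Qed.

End convex_position_law.

(** * Planar Lebesgue measure *)

Section linear_integrals.
Context {R : realType}.
Local Notation mR := (measurableTypeR R).
Local Notation mu := (@lebesgue_measure R).

Lemma lebesgue_measure_shift (r : R) (A : set mR) : measurable A ->
  mu [set x | A (x + r)] = mu A.
Proof.
move=> mA; have mf : measurable_fun [set: mR] (fun x : mR => (x + r : R) : mR).
  exact: measurable_funD.
pose f : {mfun mR >-> mR} := HB.pack (fun x : mR => (x + r : R) : mR)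
  (isMeasurableFun.Build _ _ _ _ _ mf).
rewrite (@lebesgue_measure_unique _ (pushforward mu f) _ A mA)//.
move=> _ [[a b] _ <-]; transitivity (mu `]a - r, b - r]%classic); last first.
  congr (mu _); apply/seteqP; split=> x; rewrite /= !in_itv/= ltrBlDr lerBrDr//.
rewrite !lebesgue_measure_itv/= !lte_fin ltrD2r.
by case: ifP => // _; rewrite -!EFinB; congr EFin; ring.
Qed.

Lemma integral_affine (p q a b : R) : a <= b ->
  (\int[mu]_(x in `[a, b]) (p * x + q)%:E =
   (p * (b ^+ 2 - a ^+ 2) / 2 + q * (b - a))%:E)%E.
Proof.
rewrite le_eqVlt => /orP[/eqP <-|ab].
  by rewrite set_itv1 integral_set1; congr EFin; ring.
pose F : {poly R} := (p / 2)%:P * 'X ^+ 2 + q%:P * 'X.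
have dF x : F^`().[x] = p * x + q.
  by rewrite /F !(derivD, derivM, derivC, derivX, derivXn) !hornerE /=; field.
under eq_integral do rewrite -dF.
rewrite (@continuous_FTC2 _ (horner F^`()) (horner F))//.
- by rewrite -EFinB /F !hornerE /=; congr EFin; field.
- exact/continuous_subspaceT/continuous_horner.
- split.
  + by move=> x _; exact: derivable_horner.
  + by apply: cvg_at_right_filter; exact: continuous_horner.
  + by apply: cvg_at_left_filter; exact: continuous_horner.
- by move=> x _; rewrite derivE.
Qed.

(** The bound on [e] keeps the zero of the integrand inside the interval; the two triangles under
    the graph have areas (h - e)^2 / 2 and (h + e)^2 / 2. *)
Lemma integral_norm_affine (e h : R) : `|e| <= h ->
  (\int[mu]_(y in `[(- h)%R, h]) (`|y + e|)%:E = (e ^+ 2 + h ^+ 2)%:E)%E.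
Proof.
rewrite ler_norml => /andP[he eh].
have mf A : measurable_fun (A : set mR) (fun y : mR => (`|(y : R) + e|)%:E).
  apply/measurable_EFinP; apply: measurable_funTS.
  by apply: measurableT_comp => //; exact: measurable_funD.
have e1 : (\int[mu]_(y in `[(- h)%R, (- e)%R]) (`|y + e|)%:E =
    \int[mu]_(y in `[(- h)%R, (- e)%R]) (-1 * y + - e)%:E)%E.
  apply: eq_integral => y; rewrite inE /= in_itv/= => /andP[? ?].
  by congr EFin; rewrite ler0_norm; [ring|lra].
have e2 : (\int[mu]_(y in `[(- e)%R, h]) (`|y + e|)%:E =
    \int[mu]_(y in `[(- e)%R, h]) (1 * y + e)%:E)%E.
  apply: eq_integral => y; rewrite inE /= in_itv/= => /andP[? ?].
  by congr EFin; rewrite ger0_norm; [ring|lra].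
rewrite (@itv_bndbnd_setU _ _ _ (BRight (- e)))//=; [|by rewrite bnd_simp; lra..].
rewrite ge0_integral_setU//=; last first.
  by apply/disj_setPS => y [/=]; rewrite !in_itv/= => /andP[_ ?] /andP[? _]; lra.
rewrite integral_itv_obnd_cbnd; last exact: mf.
transitivity (\int[mu]_(y in `[(- h)%R, (- e)%R]) (-1 * y + - e)%:E +
    \int[mu]_(y in `[(- e)%R, h]) (1 * y + e)%:E)%E.
  by congr (_ + _)%E; [exact: e1|exact: e2].
rewrite !integral_affine; [|lra..].
by rewrite -EFinD; congr EFin; field.
Qed.

End linear_integrals.

Section planar_measure.
Context {R : realType}.
Local Notation mR := (measurableTypeR R).
Local Notation mu := (@lebesgue_measure R).

Lemma lebesgue_planeE (X : set (mR * mR)) :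
  lebesgue_plane X = (\int[mu]_x mu [set y | X (x, y)])%E.
Proof.
rewrite /lebesgue_plane /= /product_measure1; apply: eq_integral => x _ /=.
by congr (mu _); apply/seteqP; split=> y; rewrite /xsection /= inE.
Qed.

Definition shear (g : R -> R) (p : R * R) : R * R := (p.1, p.2 + g p.1).
Definition mirror (p : R * R) : R * R := (p.1, - p.2).

Lemma measurable_shear (g : R -> R) : measurable_fun [set: mR] (g : mR -> mR) ->
  measurable_fun [set: mR * mR] (shear g : mR * mR -> mR * mR).
Proof.
move=> mg; apply/measurable_fun_pairP; split => /=.
  exact: measurable_fst.
apply: measurable_funD; first exact: measurable_snd.
by apply: (measurableT_comp mg); exact: measurable_fst.
Qed.

Lemma measurable_mirror : measurable_fun [set: mR * mR] (mirror : mR * mR -> mR * mR).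
Proof.
apply/measurable_fun_pairP; split => /=; first exact: measurable_fst.
by apply: measurable_funN; exact: measurable_snd.
Qed.

Lemma measurable_preimage d1 d2 (X : measurableType d1) (Y : measurableType d2)
  (f : X -> Y) (A : set Y) :
  measurable_fun setT f -> measurable A -> measurable (f @^-1` A).
Proof. by move=> mf mA; rewrite -[X in measurable X]setTI; exact: mf. Qed.

Lemma measurable_section (X : set (mR * mR)) x : measurable X ->
  measurable [set y : mR | X (x, y)].
Proof.
move=> mX; rewrite (_ : [set y | _] = xsection X x); first exact: measurable_xsection.
by apply/seteqP; split=> y; rewrite /xsection /= inE.
Qed.

Lemma lebesgue_plane_shear (g : R -> R) (X : set (mR * mR)) :
  measurable X -> lebesgue_plane (shear g @^-1` X) = lebesgue_plane X.
Proof.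
move=> mX; rewrite !lebesgue_planeE; apply: eq_integral => x _.
by rewrite -(lebesgue_measure_shift (g x) (measurable_section x mX)).
Qed.

Lemma lebesgue_plane_mirror (X : set (mR * mR)) :
  measurable X -> lebesgue_plane (mirror @^-1` X) = lebesgue_plane X.
Proof.
move=> mX; rewrite !lebesgue_planeE; apply: eq_integral => x _.
by rewrite -(lebesgue_measureN (measurable_section x mX)).
Qed.

Lemma in_triangle_mirror (a b c p : R * R) :
  in_triangle (mirror a) (mirror b) (mirror c) (mirror p) = in_triangle a b c p.
Proof.
have E x y z : det3 (mirror x) (mirror y) (mirror z) = - det3 x y z.
  by rewrite /det3 /mirror /=; ring.
by rewrite /in_triangle !E !oppr_gt0 !oppr_lt0 orbC.
Qed.

Lemma measurable_triangle (a b c : R * R) :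
  measurable ([set p | in_triangle a b c p] : set (mR * mR)).
Proof.
by apply: measurable_bool; apply: measurable_in_triangle => //; exact: measurable_cst.
Qed.

(** With these abscissas, a positive determinant puts [b] below the side from [a] to [c]. A vertical
    section thus runs from the higher of the lines [L1] and [L2] up to [L3], and its length is
    affine on either side of [b]. *)
Lemma lebesgue_plane_triangle_pos (a b c : R * R) : a.1 < b.1 < c.1 -> 0 < det3 a b c ->
  lebesgue_plane [set p | in_triangle a b c p] = (det3 a b c / 2)%:E.
Proof.
case: a b c => [a1 a2] [b1 b2] [c1 c2] /= /andP[ab bc].
set D := det3 _ _ _ => D0; have ac : a1 < c1 by exact: lt_trans bc.
have ab0 : b1 - a1 != 0 by rewrite gt_eqF; lra.
have bc0 : c1 - b1 != 0 by rewrite gt_eqF; lra.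
have ac0 : c1 - a1 != 0 by rewrite gt_eqF; lra.
pose L1 x := a2 + (x - a1) * (b2 - a2) / (b1 - a1).
pose L2 x := b2 + (x - b1) * (c2 - b2) / (c1 - b1).
pose L3 x := a2 + (x - a1) * (c2 - a2) / (c1 - a1).
have tE x y : in_triangle (a1, a2) (b1, b2) (c1, c2) (x, y) =
    [&& L1 x < y, L2 x < y & y < L3 x].
  have -> : (L1 x < y) = (0 < det3 (a1, a2) (b1, b2) (x, y)).
    have -> : det3 (a1, a2) (b1, b2) (x, y) = (b1 - a1) * (y - L1 x).
      by rewrite /det3 /L1 /=; field.
    by rewrite pmulr_rgt0 ?subr_gt0.
  have -> : (L2 x < y) = (0 < det3 (x, y) (b1, b2) (c1, c2)).
    have -> : det3 (x, y) (b1, b2) (c1, c2) = (c1 - b1) * (y - L2 x).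
      by rewrite /det3 /L2 /=; field.
    by rewrite pmulr_rgt0 ?subr_gt0.
  have -> : (y < L3 x) = (0 < det3 (a1, a2) (x, y) (c1, c2)).
    have -> : det3 (a1, a2) (x, y) (c1, c2) = (c1 - a1) * (L3 x - y).
      by rewrite /det3 /L3 /=; field.
    by rewrite pmulr_rgt0 ?subr_gt0.
  have : D = det3 (x, y) (b1, b2) (c1, c2) + det3 (a1, a2) (x, y) (c1, c2) +
    det3 (a1, a2) (b1, b2) (x, y) by rewrite /D /det3 /=; ring.
  rewrite /in_triangle.
  move: (det3 _ _ _) (det3 _ _ _) (det3 _ _ _) => u v w Duvw.
  by apply/orP/and3P => [[] /and3P[? ? ?]|[? ? ?]]; [split|lra|left; apply/and3P].
have e31 x : L3 x - L1 x = (x - a1) * D / ((c1 - a1) * (b1 - a1)).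
  by rewrite /D /det3 /L1 /L3 /=; field; rewrite ab0 ac0.
have e32 x : L3 x - L2 x = (c1 - x) * D / ((c1 - a1) * (c1 - b1)).
  by rewrite /D /det3 /L2 /L3 /=; field; rewrite bc0 ac0.
have e12 x : L1 x - L2 x = (b1 - x) * D / ((b1 - a1) * (c1 - b1)).
  by rewrite /D /det3 /L1 /L2 /=; field; rewrite bc0 ab0.
(* The rates at which the length of the section grows from 0 at [a] and decreases to 0 at [c]. *)
pose k1 := D / ((c1 - a1) * (b1 - a1)); pose k2 := D / ((c1 - a1) * (c1 - b1)).
have k1_gt0 : 0 < k1 by rewrite divr_gt0// mulr_gt0// subr_gt0.
have k2_gt0 : 0 < k2 by rewrite divr_gt0// mulr_gt0// subr_gt0.
have {}e31 x : L3 x - L1 x = (x - a1) * k1 by rewrite e31 mulrA.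
have {}e32 x : L3 x - L2 x = (c1 - x) * k2 by rewrite e32 mulrA.
pose h x := mu [set y | in_triangle (a1, a2) (b1, b2) (c1, c2) (x, y)].
have h1 x : a1 <= x <= b1 -> h x = (k1 * x + - (a1 * k1))%:E.
  move=> /andP[ax xb]; rewrite /h (_ : [set y | _] = `]L1 x, L3 x[%classic).
    rewrite lebesgue_measure_itv/= lte_fin -subr_gt0 e31.
    case: ltrP => [_|hx]; first by rewrite -EFinB e31; congr EFin; ring.
    have : (x - a1) * k1 = 0 by apply/eqP; rewrite eq_le hx mulr_ge0 ?subr_ge0 ?(ltW k1_gt0).
    by move=> e; congr EFin; rewrite -[LHS]e; ring.
  have L21 : L2 x <= L1 x.
    by rewrite -subr_ge0 e12 divr_ge0 ?mulr_ge0 ?(ltW D0) ?subr_ge0 ?(ltW ab) ?(ltW bc).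
  apply/seteqP; split=> y /=; rewrite tE in_itv/=; first by move=> /and3P[-> _ ->].
  by move=> /andP[L1y ->]; rewrite L1y (le_lt_trans L21).
have h2 x : b1 <= x <= c1 -> h x = (- k2 * x + c1 * k2)%:E.
  move=> /andP[bx xc]; rewrite /h (_ : [set y | _] = `]L2 x, L3 x[%classic).
    rewrite lebesgue_measure_itv/= lte_fin -subr_gt0 e32.
    case: ltrP => [_|hx]; first by rewrite -EFinB e32; congr EFin; ring.
    have : (c1 - x) * k2 = 0 by apply/eqP; rewrite eq_le hx mulr_ge0 ?subr_ge0 ?(ltW k2_gt0).
    by move=> e; congr EFin; rewrite -[LHS]e; ring.
  have L12 : L1 x <= L2 x.
    rewrite -subr_le0 e12 -mulrA mulr_le0_ge0 ?subr_le0//.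
    by rewrite divr_ge0 ?mulr_ge0 ?(ltW D0) ?subr_ge0 ?(ltW ab) ?(ltW bc).
  apply/seteqP; split=> y /=; rewrite tE in_itv/=; first by move=> /and3P[_ -> ->].
  by move=> /andP[L2y ->]; rewrite L2y (le_lt_trans L12).
have h0 x : x \notin `[a1, c1] -> h x = 0%E.
  move=> xac; rewrite /h (_ : [set y | _] = set0) ?measure0//.
  apply/seteqP; split=> y //=; rewrite tE => /and3P[l1 l2 l3].
  have ax : a1 < x by rewrite -subr_gt0 -(pmulr_lgt0 _ k1_gt0) -e31 subr_gt0 (lt_trans l1).
  have xc : x < c1 by rewrite -subr_gt0 -(pmulr_lgt0 _ k2_gt0) -e32 subr_gt0 (lt_trans l2).
  by move: xac; rewrite in_itv/= (ltW xc) (ltW ax).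
rewrite lebesgue_planeE -/h.
have -> : (\int[mu]_x h x = \int[mu]_(x in `[a1, c1]) h x)%E.
  rewrite [RHS]integral_mkcond; congr integral; apply/funext => x.
  rewrite patchE; case: ifPn => // xac; apply: h0; apply: contra xac; by rewrite inE.
have mh A : measurable_fun (A : set mR) h.
  apply: measurable_funTS; rewrite (_ : h = mu \o xsection
      [set p | in_triangle (a1, a2) (b1, b2) (c1, c2) p]).
    by apply: measurable_fun_xsection; exact: measurable_triangle.
  apply/funext => x; rewrite /h /=; congr (mu _).
  by apply/seteqP; split=> y; rewrite /xsection /= inE.
rewrite (@itv_bndbnd_setU _ _ _ (BRight b1))//=; [|by rewrite bnd_simp; lra..].
rewrite ge0_integral_setU//=; last first.
  by apply/disj_setPS => y [/=]; rewrite !in_itv/= => /andP[_ ?] /andP[? _]; lra.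
rewrite integral_itv_obnd_cbnd; last exact: mh.
transitivity (\int[mu]_(x in `[a1, b1]) (k1 * x + - (a1 * k1))%:E +
  \int[mu]_(x in `[b1, c1]) (- k2 * x + c1 * k2)%:E)%E.
  by congr (_ + _)%E; apply: eq_integral => x; rewrite inE/= in_itv/=; [move/h1|move/h2].
rewrite !integral_affine ?(ltW ab) ?(ltW bc)// -EFinD /k1 /k2; congr EFin.
by field; rewrite ab0 bc0 ac0.
Qed.

Lemma lebesgue_plane_triangle (a b c : R * R) : a.1 < b.1 < c.1 ->
  lebesgue_plane [set p | in_triangle a b c p] = (`|det3 a b c| / 2)%:E.
Proof.
move=> abc; have [D0|D0|D0] := ltgtP 0 (det3 a b c).
- by rewrite lebesgue_plane_triangle_pos// gtr0_norm.
- rewrite -(lebesgue_plane_mirror (measurable_triangle _ _ _)).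
  rewrite (_ : _ @^-1` _ =
      [set p | in_triangle (mirror a) (mirror b) (mirror c) p]); last first.
    apply/seteqP; split=> p /=; rewrite -[in X in _ -> X]in_triangle_mirror;
    by rewrite /mirror /= ?opprK -?surjective_pairing.
  have E : det3 (mirror a) (mirror b) (mirror c) = - det3 a b c.
    by rewrite /det3 /mirror /=; ring.
  by rewrite lebesgue_plane_triangle_pos// ?E ?oppr_gt0// ltr0_norm.
- rewrite -D0 normr0 mul0r (_ : [set p | _] = set0) ?measure0//.
  apply/seteqP; split=> p //=; rewrite /in_triangle.
  have : det3 a b c = det3 p b c + det3 a p c + det3 a b p by rewrite /det3; ring.
  by rewrite -D0 => e /orP[] /and3P[? ? ?]; lra.
Qed.

Lemma lebesgue_plane_vertical (r : R) :
  lebesgue_plane ([set p | p.1 = r] : set (mR * mR)) = 0%E.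
Proof.
rewrite (_ : [set p | _] = [set r] `*` setT); last by apply/seteqP; split=> p //= [].
by rewrite lebesgue_planeX// lebesgue_measure_set1 mul0e.
Qed.

Lemma lebesgue_plane_line (a b : R * R) : a.1 != b.1 ->
  lebesgue_plane ([set p | det3 a b p = 0] : set (mR * mR)) = 0%E.
Proof.
move=> ab; rewrite lebesgue_planeE; apply: integral0_eq => x _.
have ba : b.1 - a.1 != 0 by rewrite subr_eq0 eq_sym.
rewrite (_ : [set y | _] = [set a.2 + (x - a.1) * (b.2 - a.2) / (b.1 - a.1)]).
  exact: lebesgue_measure_set1.
apply/seteqP; split=> y /=; rewrite /det3 /= => e.
  by apply: (mulfI ba); apply/eqP; rewrite -subr_eq0 -[X in _ == X]e; apply/eqP; field.
by rewrite e; field.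
Qed.

End planar_measure.

(** * Bodies with prescribed vertical widths *)

Section uniform.
Context {R : realType}.
Local Notation mR := (measurableTypeR R).
Implicit Types K B : set (mR * mR).

(** [uniform_lawE] asks for compactness, while the bodies below are only known to be measurable with
    a finite positive area. *)
Lemma uniform_law_measurableE K B (a : R) : measurable K -> 0 < a ->
  lebesgue_plane K = a%:E ->
  uniform_law K B = (lebesgue_plane (B `&` K) * (a^-1)%:E)%E.
Proof.
move=> mK a0 Ka; rewrite /uniform_law; case: pselect => [mK'|//].
have KT : mrestr lebesgue_plane mK' [set: mR * mR] = a%:E.
  by rewrite /mrestr setTI.
rewrite -[LHS]/(mnormalize (mrestr lebesgue_plane mK') _ B) /mnormalize.
case: ifPn => [/orP[/eqP E|/eqP E]|_].
- by have := etrans (esym KT) E; move=> -[] a0'; rewrite a0' ltxx in a0.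
- by have := etrans (esym KT) E.
- rewrite (_ : a = fine (lebesgue_plane K)); last by rewrite Ka.
  by congr (_ * ((fine _)^-1)%:E)%E; rewrite Ka; exact: KT.
Qed.

End uniform.

Lemma probability_setI1 d (X : measurableType d) (R : realType) (P : probability X R)
  (A B : set X) : measurable A -> measurable B -> P B = 1%E -> P (A `&` B) = P A.
Proof.
move=> mA mB PB; suff e0 : P (A `\` B) = 0%E.
  transitivity (P (A `\` B) + P (A `&` B))%E; first by rewrite e0 add0e.
  exact/esym/(measureDI P mA mB).
apply/eqP; rewrite eq_le measure_ge0 andbT.
apply: (@le_trans _ _ (P (~` B))).
  by apply: le_measure; rewrite ?inE; [exact: measurableD|exact: measurableC|move=> x []].
by rewrite probability_setC// PB subee.
Qed.

Section bodies.
Context {R : realType}.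
Local Notation mR := (measurableTypeR R).
Variables (m M : R) (w : R -> R).

Definition body (g : R -> R) : set (R * R) :=
  [set p | (m <= p.1 <= M) && (`|p.2 - g p.1| <= w p.1 / 2)].

(** The defect of concavity cleared of its denominator: x3 - x1 times the height of the graph of [g]
    at x2 above the chord from x1 to x3. It is linear in [g] and vanishes on affine functions. *)
Definition dev (g : R -> R) (x1 x2 x3 : R) : R :=
  (x3 - x1) * g x2 - (x3 - x2) * g x1 - (x2 - x1) * g x3.

(* When [w] is nonnegative, the inequality says that [body g] is convex. *)
Definition admissible (g : R -> R) : Prop :=
  measurable_fun [set: mR] (g : mR -> mR) /\
  forall x1 x2 x3, m <= x1 -> x1 < x2 -> x2 < x3 -> x3 <= M ->
    `|dev g x1 x2 x3| <= dev w x1 x2 x3 / 2.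

Hypothesis mw : measurable_fun [set: mR] (w : mR -> mR).

Local Notation zero := (fun _ : R => 0 : R).

Lemma measurable_body g : measurable_fun [set: mR] (g : mR -> mR) ->
  measurable (body g : set (mR * mR)).
Proof.
move=> mg; apply: measurable_bool; apply: measurable_and.
  by apply: measurable_and; apply: measurable_fun_ler => //; exact: measurable_fst.
apply: measurable_fun_ler.
  apply: measurableT_comp => //; apply: measurable_funB; first exact: measurable_snd.
  by apply: (measurableT_comp mg); exact: measurable_fst.
apply: measurable_funM => //.
by apply: (measurableT_comp mw); exact: measurable_fst.
Qed.

Lemma shear_body g : shear g @^-1` body g = body zero.
Proof. by apply/seteqP; split=> p; rewrite /body /shear /= addrK subr0. Qed.

(** By linearity of [dev], the two signs in the bound say that the upper boundary g + w / 2 is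
    concave and the lower boundary g - w / 2 convex. Points with equal abscissas are treated
    apart. *)
Lemma convex_body g : admissible g -> convex_set (body g).
Proof.
move=> [_ ag]; apply/convex_setP => -[a1 a2] [b1 b2] s.
rewrite /body /= => /andP[/andP[ma aM] ha] /andP[/andP[mb bM] hb] /andP[].
wlog ab : a1 a2 b1 b2 s ma aM ha mb bM hb / a1 <= b1.
  move=> wl s0 s1; have [ab|ba] := leP a1 b1; first exact: wl.
  have := wl b1 b2 a1 a2 (1 - s) mb bM hb ma aM ha (ltW ba).
  rewrite (_ : 1 - (1 - s) = s); last by ring.
  by rewrite subr_ge0 gerBl [s * a1 + _]addrC [s * a2 + _]addrC; apply.
move=> s0 s1.
have [s0'|sN0] := eqVneq s 0.
  by rewrite s0' !mul0r !add0r subr0 !mul1r mb bM.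
have [s1'|sN1] := eqVneq s 1.
  by rewrite s1' subrr !mul0r !addr0 !mul1r ma aM.
have {}s0 : 0 < s by rewrite lt_neqAle eq_sym sN0.
have {}s1 : s < 1 by rewrite lt_neqAle sN1.
set x := s * a1 + _; set y := s * a2 + _.
move: ab; rewrite le_eqVlt => /orP[/eqP ab|ab].
  have -> : x = a1 by rewrite /x ab; ring.
  rewrite ma aM /=; move: ha hb; rewrite -ab !ler_norml /y => /andP[? ?] /andP[? ?].
  apply/andP; split; nra.
have xa : a1 < x by rewrite /x; nra.
have xb : x < b1 by rewrite /x; nra.
have mx : m <= x by lra.
have xM : x <= M by lra.
rewrite mx xM /=.
have := ag _ _ _ ma xa xb bM; rewrite /dev.
have -> : b1 - x = s * (b1 - a1) by rewrite /x; ring.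
have -> : x - a1 = (1 - s) * (b1 - a1) by rewrite /x; ring.
have ba0 : 0 < b1 - a1 by rewrite subr_gt0.
have e (h : R -> R) : (b1 - a1) * h x - s * (b1 - a1) * h a1 - (1 - s) * (b1 - a1) * h b1
  = (b1 - a1) * (h x - s * h a1 - (1 - s) * h b1) by ring.
rewrite !e normrM gtr0_norm// -mulrA ler_pM2l// => hd.
move: ha hb hd; rewrite !ler_norml /y => /andP[? ?] /andP[? ?] /andP[? ?].
apply/andP; split; nra.
Qed.

End bodies.

(** * All bodies as shears of the symmetric one *)

Section body_laws.
Context {R : realType}.
Local Notation mR := (measurableTypeR R).
Variables (m M : R) (w : R -> R) (A : R).
Hypothesis mw : measurable_fun [set: mR] (w : mR -> mR).
Local Notation zero := (fun _ : R => 0 : R).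
Local Notation body := (body m M w).
Local Notation admissible := (admissible m M w).
Hypothesis A_gt0 : 0 < A.
Hypothesis area0 : lebesgue_plane (body zero) = A%:E.
Local Notation K0 := (body zero).
Local Notation P0 := (uniform_law K0).

Lemma area_body g : admissible g -> lebesgue_plane (body g) = A%:E.
Proof.
move=> [mg _]; rewrite -area0 -(shear_body m M w g) lebesgue_plane_shear//.
exact: measurable_body.
Qed.

Lemma measurable_K0 : measurable (K0 : set (mR * mR)).
Proof. by apply: measurable_body => //; exact: measurable_cst. Qed.

Lemma uniform_bodyE g B : admissible g ->
  uniform_law (body g) B = (lebesgue_plane (B `&` body g) * (A^-1)%:E)%E.
Proof.
move=> ag; apply: uniform_law_measurableE => //; last exact: area_body.
by case: ag => mg _; exact: measurable_body.
Qed.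

Lemma uniform_K0E B : P0 B = (lebesgue_plane (B `&` K0) * (A^-1)%:E)%E.
Proof. by apply: uniform_law_measurableE => //; exact: measurable_K0. Qed.

Lemma uniform_body_shear g (B : set (mR * mR)) : admissible g -> measurable B ->
  uniform_law (body g) B = P0 (shear g @^-1` B).
Proof.
move=> ag mB; rewrite uniform_bodyE// uniform_K0E -(shear_body m M w g) -preimage_setI.
rewrite lebesgue_plane_shear//; apply: measurableI => //.
by case: ag => mg _; exact: measurable_body.
Qed.

Lemma uniform_K0_mirror (B : set (mR * mR)) : measurable B ->
  P0 (mirror @^-1` B) = P0 B.
Proof.
move=> mB; rewrite !uniform_K0E -[in RHS]lebesgue_plane_mirror; last first.
  by apply: measurableI => //; exact: measurable_K0.
congr (lebesgue_plane _ * _)%E; rewrite preimage_setI; congr (_ `&` _).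
by apply/seteqP; split=> p; rewrite /body /mirror /= !subr0 normrN.
Qed.

Lemma uniform_body_null g (B : set (mR * mR)) : admissible g -> measurable B ->
  lebesgue_plane B = 0%E -> uniform_law (body g) B = 0%E.
Proof.
move=> ag mB B0; rewrite uniform_bodyE// (_ : lebesgue_plane _ = 0%E) ?mul0e//.
apply/eqP; rewrite eq_le measure_ge0 andbT -B0; apply: le_measure; rewrite ?inE//.
by apply: measurableI => //; case: ag => mg _; exact: measurable_body.
Qed.

Lemma uniform_body_vertical g (r : R) : admissible g ->
  uniform_law (body g) [set p | p.1 = r] = 0%E.
Proof.
move=> ag; apply: uniform_body_null => //; last exact: lebesgue_plane_vertical.
by apply: measurable_eq_cst; exact: measurable_fst.
Qed.

Lemma uniform_body_line g (a b : R * R) : admissible g -> a.1 != b.1 ->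
  uniform_law (body g) [set p | det3 a b p = 0] = 0%E.
Proof.
move=> ag ab; apply: uniform_body_null => //; last exact: lebesgue_plane_line.
by apply: measurable_eq_cst; apply: measurable_det3 => //; exact: measurable_cst.
Qed.

Lemma triangle_sub_body g (a b c p : R * R) : admissible g ->
  body g a -> body g b -> body g c -> in_triangle a b c p -> body g p.
Proof. by move=> ag; apply: in_triangle_convex; exact: convex_body. Qed.

Lemma uniform_body_triangle g (a b c : R * R) : admissible g ->
  body g a -> body g b -> body g c -> a.1 < b.1 < c.1 ->
  uniform_law (body g) [set p | in_triangle a b c p] = (`|det3 a b c| / (2 * A))%:E.
Proof.
move=> ag ha hb hc abc; rewrite uniform_bodyE// setIidl; last first.
  by move=> p; exact: triangle_sub_body.
by rewrite lebesgue_plane_triangle// -EFinM invfM mulrA.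
Qed.

(** The analogue of [dev] for the ordinates of three points, equal to the opposite of
    [det3 a b c]. *)
Definition gap (a b c : R * R) : R :=
  (c.1 - a.1) * b.2 - (c.1 - b.1) * a.2 - (b.1 - a.1) * c.2.

(** For fixed abscissas the determinant is linear in the ordinates, so adding values of [g] to them
    adds the same expression formed with [g]. *)
Lemma det3_shear g a b c :
  det3 (shear g a) (shear g b) (shear g c) = - (gap a b c + dev g a.1 b.1 c.1).
Proof. by rewrite /det3 /shear /gap /dev /=; ring. Qed.

(** A Boolean form of membership in [K0], with a body that keeps the two convertible. *)
Definition inK (p : R * R) : bool := (m <= p.1 <= M) && (`|p.2 - zero p.1| <= w p.1 / 2).

Definition triple (a c b : R * R) : bool :=
  [&& inK a, inK c, inK b, a.1 < b.1 & b.1 < c.1].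

(* Area of the sheared triangle over the area of the body, that is the probability
   that a further point falls into the triangle. *)
Definition rel_area g (a c b : R * R) : R :=
  if triple a c b then `|gap a b c + dev g a.1 b.1 c.1| / (2 * A) else 0.

Lemma uniform_K0_full : P0 K0 = 1%E.
Proof.
by rewrite uniform_K0E setIid area0 -EFinM divff// gt_eqF.
Qed.

(** A sample of [body g] is a sheared sample of [K0]. The condition [all inK] has probability one;
    it is added so that the vertices are known to lie in the body. *)
Lemma iid_law_shear n g (E : seq (R * R) -> bool) : admissible g ->
  measurable [set t : n.-tuple (mR * mR) | E t] ->
  iid_law (uniform_law (body g)) n [set t | E t] =
  iid_law P0 n [set t : n.-tuple (mR * mR) |
    E [seq shear g p | p <- t] && all inK t].
Proof.
move=> ag mE; have mg : measurable_fun [set: mR * mR] (shear g : _ -> mR * mR).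
  by apply: measurable_shear; case: ag.
rewrite (iid_law_map mg (fun B => uniform_body_shear ag)) //.
rewrite [RHS](_ : _ = iid_law P0 n ([set t : n.-tuple (mR * mR) |
    E [seq shear g p | p <- t]] `&` [set t | forall i, K0 (tnth t i)])); last first.
  congr (iid_law P0 n _); apply/seteqP; split=> t /=.
    by move=> /andP[-> /all_tnthP h]; split=> // i; exact: h.
  by move=> [-> h]; apply/all_tnthP => i; exact: h.
apply: esym; apply: (@probability_setI1 _ _ _ (iid_law P0 n)).
- exact: (measurable_preimage (measurable_map_tuple (n := n) mg) mE).
- exact: (@measurable_box _ _ n (fun=> K0) (fun=> measurable_K0)).
- by apply: iid_law_all; [exact: measurable_K0|exact: uniform_K0_full].
Qed.

Lemma body_shearP g p : body g (shear g p) = K0 p.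
Proof. by rewrite -[RHS]/(K0 p) -(shear_body m M w g). Qed.

Lemma uniform_sheared_triangle g a c b : admissible g -> triple a c b ->
  P0 (shear g @^-1` [set p | in_triangle (shear g a) (shear g b) (shear g c) p]) =
  (rel_area g a c b)%:E.
Proof.
move=> ag abc; rewrite /rel_area abc; case/and5P: abc => Ka Kc Kb ab bc.
rewrite -uniform_body_shear//; last exact: measurable_triangle.
rewrite uniform_body_triangle ?body_shearP//; last by rewrite /= ab bc.
by rewrite det3_shear normrN.
Qed.

(** Once the vertices are drawn, in the order [a], [c], [b], the fourth point falls into their
    sheared triangle with conditional probability [rel_area]. *)
Lemma alpha_body g : admissible g ->
  alpha (uniform_law (body g)) =
  (\int[P0]_a \int[P0]_c \int[P0]_b (rel_area g a c b)%:E)%E.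
Proof.
move=> ag; rewrite /alpha (iid_law_shear (E := tri_sorted) ag); last first.
  apply: measurable_bool; under eq_fun do rewrite -map_nth_tuple.
  exact: (@measurable_tri_sorted _ 4 (iota 0 4)).
rewrite iid_lawS; apply: eq_integral => a _.
rewrite iid_lawS; apply: eq_integral => c _.
rewrite iid_lawS; apply: eq_integral => b _.
have mg : measurable_fun [set: mR * mR] (shear g : _ -> mR * mR).
  by apply: measurable_shear; case: ag.
have mT := measurable_preimage mg (measurable_triangle (shear g a) (shear g b) (shear g c)).
have [abc|nabc] := boolP (triple a c b).
  rewrite -(uniform_sheared_triangle ag abc) -(iid_law1 P0 mT).
  congr (iid_law P0 1 _); case/and5P: abc => Ka Kc Kb ab bc.
  apply/seteqP; split=> -[[|p []]//= sz]; rewrite /tri_sorted /tri /sorted3 /left_of /=.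
    by move=> /andP[/andP[]].
  move=> pT; rewrite pT ab bc Ka Kc Kb /= andbT.
  (* The fourth point must satisfy [inK] as well, which follows from the convexity of [body g]. *)
  change (K0 p); rewrite -(body_shearP g).
  by apply: triangle_sub_body ag _ _ _ pT; rewrite body_shearP.
rewrite /rel_area (negPf nabc) (_ : [set t | _] = set0) ?measure0//.
apply/seteqP; split=> -[[|p []]//= sz]; rewrite /tri_sorted /tri /sorted3 /left_of /=.
move=> /andP[/andP[_ /andP[ab bc]] /and4P[Ka Kc Kb _]].
by move: nabc; rewrite /triple Ka Kc Kb ab bc.
Qed.

(** Given the vertices, the two further points fall into the triangle independently, hence the
    square. *)
Lemma beta_body g : admissible g ->
  beta (uniform_law (body g)) =
  (\int[P0]_a \int[P0]_c \int[P0]_b (rel_area g a c b ^+ 2)%:E)%E.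
Proof.
move=> ag; rewrite /beta (iid_law_shear (E := tri2_sorted) ag); last first.
  apply: measurable_bool; under eq_fun do rewrite -map_nth_tuple.
  exact: (@measurable_tri2_sorted _ 5 (iota 0 5)).
rewrite iid_lawS; apply: eq_integral => a _.
rewrite iid_lawS; apply: eq_integral => c _.
rewrite iid_lawS; apply: eq_integral => b _.
have mg : measurable_fun [set: mR * mR] (shear g : _ -> mR * mR).
  by apply: measurable_shear; case: ag.
have mT := measurable_preimage mg (measurable_triangle (shear g a) (shear g b) (shear g c)).
have [abc|nabc] := boolP (triple a c b).
  rewrite EFin_expe expe2 -(uniform_sheared_triangle ag abc) -(iid_law2 P0 mT).
  congr (iid_law P0 2 _); case/and5P: abc => Ka Kc Kb ab bc.
  apply/seteqP; split=> -[[|p [|q []]]//= sz]; rewrite /tri2_sorted /tri /sorted3 /left_of /=.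
    by move=> /andP[/and3P[]].
  move=> [pT qT]; rewrite pT qT ab bc Ka Kc Kb /= andbT.
  apply/andP; split; [change (K0 p)|change (K0 q)]; rewrite -(body_shearP g).
    by apply: triangle_sub_body ag _ _ _ pT; rewrite body_shearP.
  by apply: triangle_sub_body ag _ _ _ qT; rewrite body_shearP.
rewrite /rel_area (negPf nabc) expr0n /= (_ : [set t | _] = set0) ?measure0//.
apply/seteqP; split=> -[[|p [|q []]]//= sz]; rewrite /tri2_sorted /tri /sorted3 /left_of /=.
move=> /andP[/and3P[_ _ /andP[ab bc]] /and5P[Ka Kc Kb _ _]].
by move: nabc; rewrite /triple Ka Kc Kb ab bc.
Qed.

End body_laws.

(** * Triple integrals *)

Section triple_integrals.
Context {d : measure_display} {V : measurableType d} {R : realType}.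
Variable P : probability V R.
Local Open Scope ereal_scope.

Definition unc (f : V -> V -> V -> R) (z : V * (V * V)) : \bar R := (f z.1 z.2.1 z.2.2)%:E.

Definition square_law : probability (V * V)%type R := (P \x P).

(** Integrating over the product rather than iteratively lets additivity and comparison be applied
    once, from the joint measurability of nonnegative integrands. *)
Definition int3 (f : V -> V -> V -> R) : \bar R := \int[P \x square_law]_z unc f z.

Lemma int3E f : measurable_fun setT (unc f) -> (forall a c b, 0 <= f a c b)%R ->
  int3 f = \int[P]_a \int[P]_c \int[P]_b (f a c b)%:E.
Proof.
move=> mf f0; rewrite /int3 (@fubini_tonelli1 _ _ _ _ _ P square_law (unc f) mf); last first.
  by move=> z; rewrite lee_fin.
apply: eq_integral => a _; apply: (@fubini_tonelli1 _ _ _ _ _ P P (fun z => unc f (a, z))).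
- by apply: (measurableT_comp mf); exact: measurable_pair1.
- by move=> z; rewrite lee_fin.
Qed.

Lemma int3D f g : measurable_fun setT (unc f) -> measurable_fun setT (unc g) ->
  (forall a c b, 0 <= f a c b)%R -> (forall a c b, 0 <= g a c b)%R ->
  int3 (fun a c b => f a c b + g a c b)%R = int3 f + int3 g.
Proof.
move=> mf mg f0 g0; rewrite /int3 -ge0_integralD//.
- by move=> z _; rewrite lee_fin.
- by move=> z _; rewrite lee_fin.
Qed.

Lemma le_int3 f g : measurable_fun setT (unc f) -> measurable_fun setT (unc g) ->
  (forall a c b, 0 <= f a c b)%R -> (forall a c b, f a c b <= g a c b)%R ->
  int3 f <= int3 g.
Proof.
move=> mf mg f0 fg; apply: ge0_le_integral => //.
- by move=> z _; rewrite lee_fin.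
- by move=> z _; rewrite lee_fin.
Qed.

Lemma eq_int3_last f g : measurable_fun setT (unc f) -> measurable_fun setT (unc g) ->
  (forall a c b, 0 <= f a c b)%R -> (forall a c b, 0 <= g a c b)%R ->
  (forall a c, \int[P]_b (f a c b)%:E = \int[P]_b (g a c b)%:E) ->
  int3 f = int3 g.
Proof.
move=> mf mg f0 g0 fg; rewrite (int3E mf f0) (int3E mg g0).
apply: eq_integral => a _; apply: eq_integral => c _; exact: fg.
Qed.

Variable phi : V -> V.
Hypothesis mphi : measurable_fun setT phi.
Hypothesis phiP : forall B, measurable B -> P (phi @^-1` B) = P B.

Lemma integral_invariant (h : V -> \bar R) : measurable_fun setT h -> (forall x, 0 <= h x) ->
  \int[P]_x h x = \int[P]_x h (phi x).
Proof.
move=> mh h0; pose psi : {mfun V >-> V} := HB.pack phi (isMeasurableFun.Build _ _ _ _ _ mphi).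
transitivity (\int[pushforward P psi]_x h x).
  by apply: eq_measure_integral => B mB _; rewrite -[LHS]phiP.
by rewrite ge0_integral_pushforward// => x _.
Qed.

Lemma measurable_unc_map f : measurable_fun setT (unc f) ->
  measurable_fun setT (unc (fun a c b => f (phi a) (phi c) (phi b))).
Proof.
move=> mf.
rewrite (_ : unc _ = unc f \o (fun z => (phi z.1, (phi z.2.1, phi z.2.2))))//.
apply: (measurableT_comp mf).
apply/measurable_fun_pairP; split.
  exact: (measurableT_comp mphi measurable_fst).
apply/measurable_fun_pairP; split.
  exact: (measurableT_comp mphi (measurableT_comp measurable_fst measurable_snd)).
exact: (measurableT_comp mphi (measurableT_comp measurable_snd measurable_snd)).
Qed.

(** The invariance of [P] is applied to the three iterated integrals in turn. It will serve for
    reflecting all three points at once. *)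
Lemma int3_invariant f : measurable_fun setT (unc f) -> (forall a c b, 0 <= f a c b)%R ->
  int3 f = int3 (fun a c b => f (phi a) (phi c) (phi b)).
Proof.
move=> mf f0.
have mfphi := measurable_unc_map mf.
have f0' z : 0 <= unc f z by rewrite lee_fin.
have msec a : measurable_fun setT (fun z : V * V => unc f (a, z)).
  exact: (measurableT_comp mf (measurable_pair1 a)).
rewrite (int3E mf f0) (int3E mfphi (fun a c b => f0 (phi a) (phi c) (phi b))).
pose H1 a := \int[square_law]_z unc f (a, z).
have H1E a : H1 a = \int[P]_c \int[P]_b (f a c b)%:E.
  exact: (@fubini_tonelli1 _ _ _ _ _ P P _ (msec a) (fun z => f0' _)).
under eq_integral do rewrite -H1E.
have mH1 : measurable_fun setT H1.
  exact: (@measurable_fun_fubini_tonelli_F _ _ _ _ _ square_law (unc f) mf f0').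
rewrite (integral_invariant mH1); last by move=> a; exact: integral_ge0.
apply: eq_integral => a _; rewrite H1E.
pose H2 c := \int[P]_b unc f (phi a, (c, b)).
have mH2 : measurable_fun setT H2.
  exact: (@measurable_fun_fubini_tonelli_F _ _ _ _ _ P _ (msec (phi a)) (fun z => f0' _)).
rewrite -[LHS]/(\int[P]_c H2 c) (integral_invariant mH2); last by move=> c; exact: integral_ge0.
apply: eq_integral => c _; apply: (integral_invariant (h := fun b => (f (phi a) (phi c) b)%:E)).
- exact: (measurableT_comp (msec (phi a)) (measurable_pair1 (phi c))).
- by move=> b; rewrite lee_fin.
Qed.

End triple_integrals.

(** * Averages over ordinates and reflections *)

Section comparison.
Context {R : realType}.
Local Notation mR := (measurableTypeR R).
Local Notation mu := (@lebesgue_measure R).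
Variables (m M : R) (w : R -> R) (A : R).
Hypothesis mw : measurable_fun [set: mR] (w : mR -> mR).
Local Notation zero := (fun _ : R => 0 : R).
Local Notation body := (body m M w).
Local Notation admissible := (admissible m M w).
Hypothesis A_gt0 : 0 < A.
Hypothesis area0 : lebesgue_plane (body zero) = A%:E.
Local Notation K0 := (body zero).
Local Notation P0 := (uniform_law K0).
Local Notation inK := (inK m M w).
Local Notation triple := (triple m M w).
Local Notation rel_area := (rel_area m M w A).
Implicit Types a b c : R * R.

(** On [K0] the uniform law is Lebesgue measure divided by [A]; Tonelli makes the ordinate the inner
    variable, ready for averaging. *)
Lemma integral_K0 (h : mR * mR -> \bar R) : measurable_fun setT h ->
  (forall p, 0 <= h p)%E -> (forall p, ~~ inK p -> h p = 0%E) ->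
  (\int[P0]_p h p = (A^-1)%:E * \int[mu]_x \int[mu]_y h (x, y))%E.
Proof.
move=> mh h0 hK; have mK := measurable_K0 m M mw.
have hE (nu : {measure set (mR * mR) -> \bar R}) :
    (\int[nu]_p h p = \int[nu]_(p in K0) h p)%E.
  rewrite [RHS]integral_mkcond; congr integral; apply/funext => p.
  by rewrite patchE; case: ifPn => //; rewrite notin_setE => /negP/hK.
have A0 : 0 <= A^-1 by rewrite invr_ge0 ltW.
rewrite hE (@eq_measure_integral _ (mR * mR)%type R (K0 : set (mR * mR)) (mscale (NngNum A0) lebesgue_plane)); last first.
  move=> B mB BK; apply: etrans (uniform_K0E mw A_gt0 area0 B) _.
  by rewrite setIidl// muleC.
rewrite ge0_integral_mscale//; last exact: measurable_funTS.
by rewrite -hE /lebesgue_plane fubini_tonelli1.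
Qed.

Lemma sqr_normr (x : R) : `|x| ^+ 2 = x ^+ 2.
Proof. by rewrite real_normK ?num_real. Qed.

(** c.1 - a.1 times the ordinate, over the abscissa of [b], of the line through [a] and [c]. *)
Definition chord (a c b : R * R) : R := (c.1 - b.1) * a.2 + (b.1 - a.1) * c.2.

(** With X = c.1 - a.1, D the value of [dev] and q that of [chord], this is the average of |X y + D
    - q| over |y| <= w b.1 / 2, divided by 2 A. The ordinate of [b] matters only for membership in
    the body. *)
Definition mean_area g (a c b : R * R) : R :=
  if triple a c b then
    ((dev g a.1 b.1 c.1 - chord a c b) ^+ 2 / ((c.1 - a.1) * w b.1)
     + (c.1 - a.1) * w b.1 / 4) / (2 * A)
  else 0.

(* Along the vertical chord over [x], [rel_area] is the absolute value of an affine
   function vanishing on that chord; [mean_area] is its average there. *)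
Lemma integral_rel_area g a c x : admissible g ->
  (\int[mu]_y (rel_area g a c (x, y))%:E = \int[mu]_y (mean_area g a c (x, y))%:E)%E.
Proof.
move=> [_ ag].
have [/and4P[Ka Kc ax xc]|nac] := boolP [&& inK a, inK c, a.1 < x & x < c.1]; last first.
  apply: eq_integral => y _; rewrite /rel_area /mean_area /triple ifF ?ifF//;
  by apply/negbTE; apply: contra nac => /and5P[-> -> _ -> ->].
have [/andP[/andP[ma aM] wa] /andP[/andP[mc cM] wc]] := (Ka, Kc).
have mxM : m <= x <= M by apply/andP; split; lra.
have tE y : triple a c (x, y) = (y \in `[(- (w x / 2))%R, w x / 2]).
  by rewrite /triple Ka Kc /inK /= ax xc mxM subr0 in_itv/= -ler_norml /= !andbT.
set D := dev g a.1 x c.1; set q := chord a c (x, 0); set X := c.1 - a.1; set h := w x / 2.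
have X0 : 0 < X by rewrite subr_gt0 (lt_trans ax).
(* [- e] is the height, relative to the centre of the section over [x], at which the line through
   the sheared outer points crosses it. Admissibility and the membership of [a] and [c] keep it in
   [-h, h]. *)
pose e := (D - q) / X.
have eh : `|e| <= h.
  rewrite /e normrM normfV (gtr0_norm X0) ler_pdivrMr// ler_norml.
  have := ag _ _ _ ma ax xc cM; rewrite -/D ler_norml /dev => /andP[].
  move: wa wc; rewrite !subr0 !ler_norml /q /chord /h /X /= => /andP[? ?] /andP[? ?] ? ?.
  by apply/andP; split; nra.
have onK (f : R -> R) : (\int[mu]_y (if triple a c (x, y) then f y else 0)%:E =
    \int[mu]_(y in `[(- h)%R, h]) (f y)%:E)%E.
  rewrite [RHS]integral_mkcond; apply: eq_integral => y _.
  by rewrite patchE tE mem_setE; case: ifP.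
rewrite !onK.
transitivity (\int[mu]_(y in `[(- h)%R, h]) ((X / (2 * A))%:E * (`|y + e|)%:E))%E.
  apply: eq_integral => y _; rewrite -EFinM; congr EFin.
  rewrite /gap /= -/D -/X (_ : _ + D = X * (y + e)).
    by rewrite normrM (gtr0_norm X0) mulrAC.
  by rewrite /e /q /chord /=; move: (X0); rewrite /X => X0'; field; rewrite gt_eqF.
have h0 : 0 <= h := le_trans (normr_ge0 e) eh.
have A2 : 0 < 2 * A by rewrite mulr_gt0.
rewrite ge0_integralZl_EFin//; last 2 first.
- apply/measurable_EFinP; apply: measurable_funTS.
  by apply: measurableT_comp => //; exact: measurable_funD.
- by rewrite divr_ge0 ?(ltW X0) ?(ltW A2).
rewrite integral_norm_affine// -EFinM.
pose C := ((D - q) ^+ 2 / (X * w x) + X * w x / 4) / (2 * A).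
transitivity (\int[mu]_(y in `[(- h)%R, h]) (0 * y + C)%:E)%E; last first.
  by apply: eq_integral => y _; congr EFin; rewrite mul0r add0r /C /q /chord.
rewrite integral_affine; last by lra.
congr EFin; rewrite /C; have wE : w x = 2 * h by rewrite /h; field.
have eE : D - q = X * e by rewrite /e mulrC divfK// gt_eqF.
(* On a section of length 0 the formula for [C] divides by 0, but both sides vanish, because |e| <=
   h forces e = 0. *)
have [h0'|hN0] := eqVneq h 0.
  have -> : e = 0 by apply/eqP; rewrite -normr_le0 -h0'.
  by rewrite h0'; ring.
rewrite eE wE; field; rewrite hN0 !gt_eqF//.
Qed.

Lemma chord_mirror a c b : chord (mirror a) (mirror c) (mirror b) = - chord a c b.
Proof. by rewrite /chord /=; ring. Qed.

Lemma triple_mirror a c b : triple (mirror a) (mirror c) (mirror b) = triple a c b.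
Proof. by rewrite /triple /inK /mirror /= !subr0 !normrN. Qed.

Lemma gap_mirror a b c : gap (mirror a) (mirror b) (mirror c) = - gap a b c.
Proof. by rewrite /gap /=; ring. Qed.

(** The sum of [mean_area] over a triple and its mirror image. Reflection changes the sign of
    [chord] and preserves [dev], so the cross term cancels, and doubling turns the factor 2 A into
    A. *)
Definition sym_mean_area g (a c b : R * R) : R :=
  if triple a c b then
    (((dev g a.1 b.1 c.1) ^+ 2 + chord a c b ^+ 2) / ((c.1 - a.1) * w b.1)
     + (c.1 - a.1) * w b.1 / 4) / A
  else 0.

Definition sym_sqr_area g (a c b : R * R) : R :=
  if triple a c b then ((gap a b c) ^+ 2 + (dev g a.1 b.1 c.1) ^+ 2) / (2 * A ^+ 2) else 0.

Lemma mean_area_mirrorD g a c b :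
  mean_area g a c b + mean_area g (mirror a) (mirror c) (mirror b) = sym_mean_area g a c b.
Proof.
rewrite /mean_area /sym_mean_area triple_mirror; case: ifP => _; last by rewrite addr0.
rewrite chord_mirror /mirror /= opprK; set D := dev _ _ _ _; set q := chord _ _ _.
move: ((c.1 - a.1) * w b.1)^-1 => Y; move: ((c.1 - a.1) * w b.1) => Z.
have A0 : A != 0 by rewrite gt_eqF.
by field.
Qed.

Lemma sqr_area_mirrorD g a c b :
  rel_area g a c b ^+ 2 + rel_area g (mirror a) (mirror c) (mirror b) ^+ 2 =
  sym_sqr_area g a c b.
Proof.
rewrite /rel_area /sym_sqr_area triple_mirror; case: ifP => _; last by rewrite expr0n addr0.
rewrite gap_mirror /mirror /= !exprMn !sqr_normr.
have A0 : A != 0 by rewrite gt_eqF.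
by field.
Qed.

Lemma admissible_zero g : admissible g -> admissible zero.
Proof.
move=> [_ ag]; split; first exact: measurable_cst.
move=> x1 x2 x3 m1 x12 x23 x3M; rewrite /dev !mulr0 !subr0 normr0.
by rewrite (le_trans (normr_ge0 _) (ag _ _ _ m1 x12 x23 x3M)).
Qed.

(* The two triangles with base [a.1, c.1] on the axis and apexes at the ends of the
   vertical chord over [b.1] are disjoint and contained in the body. *)
Lemma width_le_area g a c b : admissible g -> triple a c b ->
  (c.1 - a.1) * w b.1 <= 2 * A.
Proof.
move=> /admissible_zero ag0 /and5P[/andP[aI wa] /andP[cI wc] /andP[bI wb] ab bc].
have w_ge0 (x y : R) : `|y| <= w x / 2 -> 0 <= w x.
  by move=> /(le_trans (normr_ge0 _)); rewrite pmulr_lge0 ?invr_gt0.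
have X0 : 0 < c.1 - a.1 by rewrite subr_gt0 (lt_trans ab).
have := w_ge0 _ _ wb; rewrite le_eqVlt => /orP[/eqP <-|w0].
  by rewrite mulr0 mulr_ge0 ?ltW.
pose T s := [set p | in_triangle (a.1, 0) (b.1, s) (c.1, 0) p].
have KT s : `|s| <= w b.1 / 2 -> T s `<=` K0.
  move=> hs p; apply: (triangle_sub_body ag0); rewrite /body /= ?subr0 ?normr0.
  - by rewrite aI divr_ge0// (w_ge0 _ _ wa).
  - by rewrite bI.
  - by rewrite cI divr_ge0// (w_ge0 _ _ wc).
have detE s : det3 (a.1, 0) (b.1, s) (c.1, 0) = - ((c.1 - a.1) * s).
  by rewrite /det3 /=; ring.
have area s : lebesgue_plane (T s) = ((c.1 - a.1) * `|s| / 2)%:E.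
  by rewrite lebesgue_plane_triangle ?ab//= detE normrN normrM (gtr0_norm X0).
(* The sum of the three determinants has the sign of - s and the middle one that of - p.2, so [p]
   lies on the same side of the axis as the apex. This makes the triangles with opposite apexes
   disjoint. *)
have sign s p : T s p -> 0 < s * p.2.
  have : det3 p (b.1, s) (c.1, 0) + det3 (a.1, 0) p (c.1, 0) + det3 (a.1, 0) (b.1, s) p =
      - ((c.1 - a.1) * s) by rewrite -detE /det3 /=; ring.
  have : det3 (a.1, 0) p (c.1, 0) = - ((c.1 - a.1) * p.2) by rewrite /det3 /=; ring.
  rewrite /T /= /in_triangle.
  move: (det3 p _ _) (det3 _ p _) (det3 _ _ p) => x y z -> e.
  have sgn (r : R) : ((c.1 - a.1) * r < 0) = (r < 0) by rewrite pmulr_rlt0.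
  case/orP=> /and3P[x0 y0 z0].
    have : (c.1 - a.1) * p.2 < 0 by lra.
    have : (c.1 - a.1) * s < 0 by lra.
    by rewrite !sgn => s0 p0; rewrite nmulr_rgt0.
  have : 0 < (c.1 - a.1) * p.2 by lra.
  have : 0 < (c.1 - a.1) * s by lra.
  by rewrite !(pmulr_rgt0 _ X0) => s0 p0; rewrite mulr_gt0.
set h := w b.1 / 2; have h0 : 0 < h by rewrite divr_gt0.
have TT : T h `&` T (- h) = set0.
  apply/seteqP; split=> p // [/sign + /sign]; rewrite mulNr.
  by move=> ? ?; lra.
suff : (((c.1 - a.1) * h)%:E <= A%:E)%E.
  by rewrite lee_fin /h; lra.
have -> : ((c.1 - a.1) * h)%:E = lebesgue_plane (T h `|` T (- h)).
  transitivity (lebesgue_plane (T h) + lebesgue_plane (T (- h)%R))%E.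
    by rewrite !area normrN (gtr0_norm h0) -EFinD; congr EFin; field.
  by apply/esym/measureU => //; exact: measurable_triangle.
rewrite -area0; apply: le_measure; rewrite ?inE.
- by apply: measurableU; exact: measurable_triangle.
- exact: measurable_K0.
- by move=> p [|]; apply: KT; rewrite ?normrN (gtr0_norm h0).
Qed.

Lemma sym_mean_area_le g g' a c b :
  (triple a c b -> `|dev g a.1 b.1 c.1| <= `|dev g' a.1 b.1 c.1|) ->
  sym_mean_area g a c b <= sym_mean_area g' a c b.
Proof.
rewrite /sym_mean_area; case: ifPn => // abc /(_ isT) dd.
case/and5P: abc => _ _ /andP[_ wb] ab bc.
rewrite ler_pM2r ?invr_gt0// lerD2r ler_wpM2r//; last first.
  by rewrite lerD2r -[leLHS]sqr_normr -[leRHS]sqr_normr lerXn2r ?nnegrE.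
rewrite invr_ge0 mulr_ge0// ?subr_ge0; first by rewrite ltW// (lt_trans ab).
by have := le_trans (normr_ge0 _) wb; rewrite pmulr_lge0 ?invr_gt0.
Qed.

(** With Z = (c.1 - a.1) * w b.1, the difference of the two sides is (D'^2 - D^2) (2 A - Z) / (2 A^2
    Z), and [width_le_area] gives Z <= 2 A. This is the monotonicity of E T - E T^2 before
    integration. *)
Lemma sym_area_exchange g g' a c b : admissible g -> admissible g' ->
  (triple a c b -> `|dev g a.1 b.1 c.1| <= `|dev g' a.1 b.1 c.1|) ->
  sym_mean_area g a c b + sym_sqr_area g' a c b <=
  sym_mean_area g' a c b + sym_sqr_area g a c b.
Proof.
move=> [mg ag] [_ ag']; rewrite /sym_mean_area /sym_sqr_area.
have [abc /(_ isT) dd|] := ifPn; last by rewrite addr0.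
have wA := width_le_area (conj mg ag) abc.
case/and5P: abc => /andP[/andP[ma aM] wa] /andP[/andP[mc cM] wc] /andP[_ wb] ab bc.
set D := dev g _ _ _ in dd *; set D' := dev g' _ _ _ in dd *; set q := chord _ _ _; set u := gap _ _ _.
have X0 : 0 < c.1 - a.1 by rewrite subr_gt0 (lt_trans ab).
have w0 : 0 <= w b.1 by have := le_trans (normr_ge0 _) wb; rewrite pmulr_lge0 ?invr_gt0.
have d2 : D ^+ 2 <= D' ^+ 2.
  by rewrite -[leLHS]sqr_normr -[leRHS]sqr_normr lerXn2r ?nnegrE.
set Z := (c.1 - a.1) * w b.1 in wA *.
(* If Z = 0 the width at [b.1] is 0, so [dev w] is at most 0 there; admissibility then forces D' =
   0, and D = 0 follows. *)
have [Z0|ZN0] := eqVneq Z 0.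
  have D'0 : D' = 0.
    have wb0 : w b.1 = 0 by move/eqP: Z0; rewrite mulf_eq0 gt_eqF//= => /eqP.
    have := ag' _ _ _ ma ab bc cM; rewrite -/D' /dev wb0.
    have wa0 : 0 <= w a.1 by have := le_trans (normr_ge0 _) wa; rewrite pmulr_lge0 ?invr_gt0.
    have wc0 : 0 <= w c.1 by have := le_trans (normr_ge0 _) wc; rewrite pmulr_lge0 ?invr_gt0.
    move=> h; apply/eqP; rewrite -normr_le0 (le_trans h)//.
    have ? : 0 <= (c.1 - b.1) * w a.1 by rewrite mulr_ge0 ?subr_ge0 ?(ltW bc).
    have ? : 0 <= (b.1 - a.1) * w c.1 by rewrite mulr_ge0 ?subr_ge0 ?(ltW ab).
    lra.
  have D0 : D = 0.
    by apply/eqP; rewrite -sqrf_eq0 eq_le sqr_ge0 andbT (le_trans d2)// D'0 expr0n.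
  by rewrite D0 D'0.
have {ZN0}Z0 : 0 < Z by rewrite lt_neqAle eq_sym ZN0 mulr_ge0 ?(ltW X0).
rewrite -subr_ge0 [leRHS](_ : _ = (D' ^+ 2 - D ^+ 2) * (2 * A - Z) / (2 * A ^+ 2 * Z)).
  apply: divr_ge0; first by apply: mulr_ge0; rewrite subr_ge0.
  by apply: mulr_ge0 (ltW Z0); rewrite mulr_ge0// exprn_ge0// ltW.
have A0 : A != 0 by rewrite gt_eqF.
have ZN0 : Z != 0 by rewrite gt_eqF.
by field; rewrite A0 ZN0.
Qed.

End comparison.

(** The real power is applied to the nonnegative f^2, and the factor f restores the sign of the
    inverse. Where f vanishes both expressions are 0. *)
Lemma measurable_funV d (X : measurableType d) (R : realType) (f : X -> R) :
  measurable_fun setT f -> measurable_fun setT (fun x => (f x)^-1).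
Proof.
move=> mf; rewrite (_ : (fun _ => _) = (fun x => f x * (f x ^+ 2) `^ (-1))); last first.
  apply/funext => x; rewrite powR_inv1 ?sqr_ge0//.
  have [->|fx0] := eqVneq (f x) 0; first by rewrite invr0 mul0r.
  by rewrite expr2 invfM mulrA divff// mul1r.
apply: measurable_funM => //; apply: (measurableT_comp (measurable_powR (-1))).
exact: measurable_funX.
Qed.

(** The probabilities are 1 - 24 alpha for four points and 1 - 60 alpha + 60 beta for five, so
    comparisons of alpha and of alpha - beta suffice. They are assumed doubled and without
    subtraction, as the reflection argument yields them. *)
Lemma convex_position_law_le (R : realType)
    (P P' : probability (measurableTypeR R * measurableTypeR R)%type R) n :
  (forall r : R, P [set p | p.1 = r] = 0%E) ->
  (forall a b : R * R, a.1 != b.1 -> P [set p | det3 a b p = 0] = 0%E) ->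
  (forall r : R, P' [set p | p.1 = r] = 0%E) ->
  (forall a b : R * R, a.1 != b.1 -> P' [set p | det3 a b p = 0] = 0%E) ->
  (alpha P + alpha P <= alpha P' + alpha P')%E ->
  ((alpha P + alpha P) + (beta P' + beta P') <=
   (alpha P' + alpha P') + (beta P + beta P))%E ->
  n = 4%N \/ n = 5%N ->
  (iid_law P' n [set t | convex_position t] <= iid_law P n [set t | convex_position t])%E.
Proof.
move=> vert line vert' line' + + n45; have mC := @measurable_convex_position R _ n45.
have [a ea] := alpha_fin P; have [a' ea'] := alpha_fin P'.
have [b eb] := beta_fin P; have [b' eb'] := beta_fin P'.
have [q eq] := probability_fin (iid_law P n) mC.
have [q' eq'] := probability_fin (iid_law P' n) mC.
rewrite ea ea' eb eb' eq eq' -!EFinD !lee_fin => le1 le2.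
case: n45 mC eq eq' => -> _ eq eq'.
  have := convex_position4 vert line; have := convex_position4 vert' line'.
  by rewrite eq eq' ea ea' -!EFinM -!EFinD => -[e'] [e]; lra.
have := convex_position5 vert line; have := convex_position5 vert' line'.
by rewrite eq eq' ea ea' eb eb' -!EFinM -!EFinD => -[e'] [e]; lra.
Qed.

(** * Comparison of two bodies of equal widths *)

Section convex_position_bodies.
Context {R : realType}.
Local Notation mR := (measurableTypeR R).
Variables (m M : R) (w : R -> R) (A : R).
Hypothesis mw : measurable_fun [set: mR] (w : mR -> mR).
Local Notation zero := (fun _ : R => 0 : R).
Local Notation body := (body m M w).
Local Notation admissible := (admissible m M w).
Hypothesis A_gt0 : 0 < A.
Hypothesis area0 : lebesgue_plane (body zero) = A%:E.
Local Notation K0 := (body zero).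
Local Notation P0 := (uniform_law K0).
Local Notation inK := (inK m M w).
Local Notation triple := (triple m M w).
Local Notation rel_area := (rel_area m M w A).
Local Notation mean_area := (mean_area m M w A).
Local Notation sym_mean_area := (sym_mean_area m M w A).
Local Notation sym_sqr_area := (sym_sqr_area m M w A).
Local Notation V := (mR * mR)%type.
Local Notation uncV f := (@unc _ (mR * mR)%type R f).
Local Notation V3 := (V * (V * V))%type.

Let pa (z : V3) : V := z.1.
Let pc (z : V3) : V := z.2.1.
Let pb (z : V3) : V := z.2.2.

Let mpa : measurable_fun setT pa. Proof. exact: measurable_fst. Qed.
Let mpc : measurable_fun setT pc.
Proof. exact: (measurableT_comp measurable_fst measurable_snd). Qed.
Let mpb : measurable_fun setT pb.
Proof. exact: (measurableT_comp measurable_snd measurable_snd). Qed.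

Let measurable_inK (p : V3 -> V) : measurable_fun setT p ->
  measurable_fun setT (fun z => inK (p z)).
Proof.
move=> mp; have m1 := measurable_fst_comp mp; have m2 := measurable_snd_comp mp.
apply: measurable_and.
  by apply: measurable_and; apply: measurable_fun_ler.
apply: measurable_fun_ler.
  by apply: measurableT_comp => //; exact: measurable_funB.
by apply: measurable_funM => //; exact: (measurableT_comp mw m1).
Qed.

Lemma measurable_triple : measurable_fun setT (fun z => triple (pa z) (pc z) (pb z)).
Proof.
do ![apply: measurable_and; first exact: measurable_inK].
by apply: measurable_and; apply: measurable_fun_ltr; exact: measurable_fst_comp.
Qed.

Lemma measurable_dev (g : R -> R) : measurable_fun [set: mR] (g : mR -> mR) ->
  measurable_fun setT (fun z => dev g (pa z).1 (pb z).1 (pc z).1).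
Proof.
move=> mg; have mx (p : V3 -> V) : measurable_fun setT p ->
    measurable_fun setT (fun z => (p z).1 : R) by exact: measurable_fst_comp.
have mgx (p : V3 -> V) : measurable_fun setT p ->
    measurable_fun setT (fun z => g (p z).1 : R).
  by move=> /mx mp; exact: (measurableT_comp mg mp).
by apply: measurable_funB; [apply: measurable_funB|]; apply: measurable_funM;
  try (exact: mgx); apply: measurable_funB; exact: mx.
Qed.

Lemma measurable_gap : measurable_fun setT (fun z => gap (pa z) (pb z) (pc z)).
Proof.
apply: measurable_funB; [apply: measurable_funB|]; apply: measurable_funM;
  try (exact: measurable_snd_comp);
  by apply: measurable_funB; exact: measurable_fst_comp.
Qed.

Lemma measurable_chord : measurable_fun setT (fun z => chord (pa z) (pc z) (pb z)).
Proof.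
apply: measurable_funD; apply: measurable_funM;
  try (exact: measurable_snd_comp);
  by apply: measurable_funB; exact: measurable_fst_comp.
Qed.

Let measurable_if_triple (f : V3 -> R) : measurable_fun setT f ->
  measurable_fun setT (fun z => (if triple (pa z) (pc z) (pb z) then f z else 0)%:E).
Proof.
move=> mf; apply/measurable_EFinP; apply: measurable_fun_ifT => //.
exact: measurable_triple.
Qed.

Lemma measurable_rel_area g : admissible g -> measurable_fun setT (uncV (rel_area g)).
Proof.
move=> [mg _]; apply: measurable_if_triple; apply: measurable_funM => //.
apply: measurableT_comp => //; apply: measurable_funD; first exact: measurable_gap.
exact: measurable_dev.
Qed.

Lemma measurable_sqr_area g : admissible g ->
  measurable_fun setT (uncV (fun a c b => rel_area g a c b ^+ 2)).
Proof.
move=> ag; apply/measurable_EFinP; apply: measurable_funX.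
by have /measurable_EFinP := measurable_rel_area ag.
Qed.

Let measurable_width : measurable_fun setT (fun z => ((pc z).1 - (pa z).1) * w (pb z).1).
Proof.
apply: measurable_funM; last exact: (measurableT_comp mw (measurable_fst_comp mpb)).
by apply: measurable_funB; exact: measurable_fst_comp.
Qed.

Let measurable_inv_width :
  measurable_fun setT (fun z => (((pc z).1 - (pa z).1) * w (pb z).1)^-1).
Proof. exact: measurable_funV. Qed.

Lemma measurable_mean_area g : admissible g -> measurable_fun setT (uncV (mean_area g)).
Proof.
move=> [mg _]; apply: measurable_if_triple; apply: measurable_funM => //.
apply: measurable_funD; apply: measurable_funM => //.
apply: measurable_funX; apply: measurable_funB; first exact: measurable_dev.
exact: measurable_chord.
Qed.

Lemma measurable_sym_mean_area g : admissible g ->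
  measurable_fun setT (uncV (sym_mean_area g)).
Proof.
move=> [mg _]; apply: measurable_if_triple; apply: measurable_funM => //.
apply: measurable_funD; apply: measurable_funM => //.
apply: measurable_funD; apply: measurable_funX; first exact: measurable_dev.
exact: measurable_chord.
Qed.

Lemma measurable_sym_sqr_area g : admissible g ->
  measurable_fun setT (uncV (sym_sqr_area g)).
Proof.
move=> [mg _]; apply: measurable_if_triple; apply: measurable_funM => //.
apply: measurable_funD; apply: measurable_funX; last exact: measurable_dev.
exact: measurable_gap.
Qed.

Let A2_ge0 : 0 <= 2 * A. Proof. by rewrite mulr_ge0// ltW. Qed.

Lemma rel_area_ge0 g a c b : 0 <= rel_area g a c b.
Proof. by rewrite /rel_area; case: ifP => // _; rewrite divr_ge0. Qed.

Let width_ge0 a c b : triple a c b -> 0 <= (c.1 - a.1) * w b.1.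
Proof.
move=> /and5P[_ _ /andP[_ wb] ab bc]; rewrite mulr_ge0 ?subr_ge0 ?(ltW (lt_trans ab bc))//.
by have := le_trans (normr_ge0 _) wb; rewrite pmulr_lge0 ?invr_gt0.
Qed.

Lemma mean_area_ge0 g a c b : 0 <= mean_area g a c b.
Proof.
rewrite /mean_area; case: ifPn => // /width_ge0 w0; rewrite divr_ge0//.
by rewrite addr_ge0 ?divr_ge0 ?sqr_ge0.
Qed.

Lemma sym_mean_area_ge0 g a c b : 0 <= sym_mean_area g a c b.
Proof. by rewrite -mean_area_mirrorD// addr_ge0 ?mean_area_ge0. Qed.

Lemma sym_sqr_area_ge0 g a c b : 0 <= sym_sqr_area g a c b.
Proof. by rewrite -sqr_area_mirrorD// addr_ge0 ?sqr_ge0. Qed.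

(** Averaging over the ordinate of [b] replaces [rel_area] by [mean_area]; then one of the two
    copies is reflected and the integrands are added. *)
Lemma alpha_double g : admissible g ->
  (alpha (uniform_law (body g)) + alpha (uniform_law (body g)) = int3 P0 (sym_mean_area g))%E.
Proof.
move=> ag; have mrel := measurable_rel_area ag; have mmean := measurable_mean_area ag.
have mPmirror B : measurable B -> P0 (mirror @^-1` B) = P0 B.
  exact: (uniform_K0_mirror mw A_gt0 area0).
have -> : alpha (uniform_law (body g)) = int3 P0 (mean_area g).
  rewrite (alpha_body mw A_gt0 area0 ag) -(int3E P0 mrel (rel_area_ge0 g)).
  apply: (eq_int3_last mrel mmean) => [a c b|a c b|a c].
  - exact: rel_area_ge0.
  - exact: mean_area_ge0.
  have notK (b : R * R) : ~~ inK b -> triple a c b = false.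
    by move=> nK; apply/negbTE; apply: contra nK => /and5P[].
  have msec (f : V -> V -> V -> R) : measurable_fun setT (uncV f) ->
      measurable_fun setT (fun b => (f a c b)%:E).
    move=> mf; exact: (measurableT_comp (measurableT_comp mf (measurable_pair1 a))
      (measurable_pair1 c)).
  rewrite (integral_K0 mw A_gt0 area0 (msec _ mrel)); last 2 first.
  - by move=> b; rewrite lee_fin rel_area_ge0.
  - by move=> b nK; rewrite /rel_area notK.
  rewrite (integral_K0 mw A_gt0 area0 (msec _ mmean)); last 2 first.
  - by move=> b; rewrite lee_fin mean_area_ge0.
  - by move=> b nK; rewrite /mean_area notK.
  by congr (_ * _)%E; apply: eq_integral => x _; exact: integral_rel_area.
have mmean' := measurable_unc_map measurable_mirror mmean.
rewrite {2}(int3_invariant measurable_mirror mPmirror mmean (mean_area_ge0 g)).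
rewrite -(int3D P0 mmean mmean' (mean_area_ge0 g)); last by move=> *; exact: mean_area_ge0.
congr int3; apply/funext => a; apply/funext => c; apply/funext => b.
exact: mean_area_mirrorD.
Qed.

(** The square removes the absolute value in [rel_area], so the reflection applies without averaging
    over an ordinate. *)
Lemma beta_double g : admissible g ->
  (beta (uniform_law (body g)) + beta (uniform_law (body g)) = int3 P0 (sym_sqr_area g))%E.
Proof.
move=> ag; have msqr := measurable_sqr_area ag.
have sqr_ge0 a c b : 0 <= rel_area g a c b ^+ 2 by exact: sqr_ge0.
have mPmirror B : measurable B -> P0 (mirror @^-1` B) = P0 B.
  exact: (uniform_K0_mirror mw A_gt0 area0).
have msqr' := measurable_unc_map measurable_mirror msqr.
rewrite (beta_body mw A_gt0 area0 ag) -(int3E P0 msqr sqr_ge0).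
rewrite {2}(int3_invariant measurable_mirror mPmirror msqr sqr_ge0).
rewrite -(int3D P0 msqr msqr' sqr_ge0); last by move=> *; exact: sqr_ge0.
congr int3; apply/funext => a; apply/funext => c; apply/funext => b.
exact: sqr_area_mirrorD.
Qed.

Variables g g' : R -> R.
Hypotheses (ag : admissible g) (ag' : admissible g').
Hypothesis dev_le : forall x1 x2 x3, m <= x1 -> x1 < x2 -> x2 < x3 -> x3 <= M ->
  `|dev g x1 x2 x3| <= `|dev g' x1 x2 x3|.

Let dev_le_triple a c b : triple a c b ->
  `|dev g a.1 b.1 c.1| <= `|dev g' a.1 b.1 c.1|.
Proof.
by move=> /and5P[/andP[/andP[ma _] _] /andP[/andP[_ cM] _] _ ab bc]; exact: dev_le.
Qed.

Lemma alpha_double_le : (alpha (uniform_law (body g)) + alpha (uniform_law (body g)) <=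
  alpha (uniform_law (body g')) + alpha (uniform_law (body g')))%E.
Proof.
rewrite [leLHS](alpha_double ag) [leRHS](alpha_double ag'); apply: le_int3.
- exact: measurable_sym_mean_area.
- exact: measurable_sym_mean_area.
- exact: sym_mean_area_ge0.
- by move=> a c b; apply: sym_mean_area_le => // /dev_le_triple.
Qed.

Lemma alpha_beta_double_le :
  ((alpha (uniform_law (body g)) + alpha (uniform_law (body g))) +
   (beta (uniform_law (body g')) + beta (uniform_law (body g'))) <=
   (alpha (uniform_law (body g')) + alpha (uniform_law (body g'))) +
   (beta (uniform_law (body g)) + beta (uniform_law (body g))))%E.
Proof.
rewrite [X in (X + _ <= _)%E](alpha_double ag) [X in (_ + X <= _)%E](beta_double ag').
rewrite [X in (_ <= X + _)%E](alpha_double ag') [X in (_ <= _ + X)%E](beta_double ag).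
have m1 := measurable_sym_mean_area ag; have m1' := measurable_sym_mean_area ag'.
have m2 := measurable_sym_sqr_area ag; have m2' := measurable_sym_sqr_area ag'.
rewrite -[leLHS](int3D P0 m1 m2' (sym_mean_area_ge0 g) (sym_sqr_area_ge0 g')).
rewrite -[leRHS](int3D P0 m1' m2 (sym_mean_area_ge0 g') (sym_sqr_area_ge0 g)).
apply: le_int3.
- exact: emeasurable_funD m1 m2'.
- exact: emeasurable_funD m1' m2.
- by move=> a c b; rewrite addr_ge0 ?sym_mean_area_ge0 ?sym_sqr_area_ge0.
- by move=> a c b; apply: sym_area_exchange => // /dev_le_triple.
Qed.

Lemma Q_body_le n : n = 4%N \/ n = 5%N -> (Q n (body g') <= Q n (body g))%E.
Proof.
apply: convex_position_law_le.
- by move=> r; apply: (uniform_body_vertical mw A_gt0 area0).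
- by move=> a b; apply: (uniform_body_line mw A_gt0 area0).
- by move=> r; apply: (uniform_body_vertical mw A_gt0 area0).
- by move=> a b; apply: (uniform_body_line mw A_gt0 area0).
- exact: alpha_double_le.
- exact: alpha_beta_double_le.
Qed.

End convex_position_bodies.

(** * Compact convex sets *)

(** By concavity the part of {f > r} over [m, M] is an interval; off [m, M], where f is 0, either
    every point or none belongs to the set. *)
Lemma measurable_concave (R : realType) (m M : R) (f : R -> R) :
  (forall x1 x2 x3, m <= x1 -> x1 < x2 -> x2 < x3 -> x3 <= M -> 0 <= dev f x1 x2 x3) ->
  (forall x, ~~ (m <= x <= M) -> f x = 0) ->
  measurable_fun [set: measurableTypeR R] (f : _ -> measurableTypeR R).
Proof.
move=> concave f0; apply: (measurability _ (RGenOInfty.measurableE R)) => //.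
move=> _ [_ [r ->] <-]; rewrite setTI.
rewrite (_ : _ @^-1` _ = [set x | m <= x <= M /\ r < f x] `|`
    (~` `[m, M] `&` [set x | r < 0])); last first.
  apply/seteqP; split=> [x|x [[_ rf]|[xmM /= r0]]]; rewrite /= in_itv/= ?andbT//.
    have [xmM|xmM] := boolP (m <= x <= M) => rf; [by left|right].
    by rewrite in_itv/= (negPf xmM); split=> //; rewrite -(f0 _ xmM).
  by move: xmM; rewrite /= in_itv/= => /negP/f0 ->.
apply: measurableU; last first.
  apply: measurableI; first exact: measurableC.
  have [r0|r0] := ltrP r 0.
    by rewrite (_ : [set x | _] = setT)//; apply/seteqP; split.
  by rewrite (_ : [set x | _] = set0)//; apply/seteqP; split.
apply: is_interval_measurable => x y [/andP[mx xM] rx] [/andP[my yM] ry] z /andP[xz zy].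
split; first by apply/andP; split; lra.
have [->//|xNz] := eqVneq z x; have [->//|yNz] := eqVneq z y.
have xz' : x < z by rewrite lt_neqAle eq_sym xNz.
have zy' : z < y by rewrite lt_neqAle yNz.
have := concave _ _ _ mx xz' zy' yM; rewrite /dev => h.
have e : (y - x) * r = (y - z) * r + (z - x) * r by ring.
have h1 : (y - z) * r < (y - z) * f x by rewrite ltr_pM2l ?subr_gt0.
have h2 : (z - x) * r < (z - x) * f y by rewrite ltr_pM2l ?subr_gt0.
by rewrite -(@ltr_pM2l _ (y - x)) ?subr_gt0 ?(lt_trans xz')//; lra.
Qed.

Section compact_reals.
Context {R : realType}.
Implicit Types E : set R.

Lemma compact_has_ub E : compact E -> has_ubound E.
Proof.
move=> /compact_bounded[N [_ HN]]; exists (N + 1) => x Ex.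
by apply: le_trans (ler_norm x) _; apply: HN; rewrite ?ltrDl.
Qed.

Lemma compact_oppr E : compact E -> compact (-%R @` E).
Proof.
move=> cE; apply: continuous_compact => //; apply: continuous_subspaceT.
exact: opp_continuous.
Qed.

Lemma compact_sup_mem E : compact E -> E !=set0 -> E (sup E).
Proof.
move=> cE E0; have := closure_sup E0 (compact_has_ub cE).
by rewrite -(closure_id E).1//; apply: compact_closed.
Qed.

Lemma compact_inf_mem E : compact E -> E !=set0 -> E (inf E).
Proof.
move=> cE [x Ex]; have [|y Ey e] := compact_sup_mem (compact_oppr cE).
  by exists (- x), x.
by rewrite /inf -e opprK.
Qed.

Lemma compact_le_sup E x : compact E -> E x -> x <= sup E.
Proof. by move=> cE Ex; apply: ub_le_sup => //; exact: compact_has_ub. Qed.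

Lemma compact_ge_inf E x : compact E -> E x -> inf E <= x.
Proof.
move=> cE Ex; rewrite /inf lerNl; apply: compact_le_sup; first exact: compact_oppr.
by exists x.
Qed.

End compact_reals.

Section convex_bodies.
Context {R : realType}.
Local Notation mR := (measurableTypeR R).
Variable H : set (R * R).
Hypotheses (cH : compact H) (cvH : @convex_set R (R * R)%type H) (iH : interior H !=set0).

Local Notation m := (xmin H).
Local Notation M := (xmax H).

Let cproj : compact [set p.1 | p in H].
Proof.
apply: continuous_compact => //; apply: continuous_subspaceT => p; exact: cvg_fst.
Qed.

Let H0 : H !=set0.
Proof. by case: iH => p /interior_subset Hp; exists p. Qed.

Let csec x : compact [set y | H (x, y)].
Proof.
rewrite (_ : [set y | _] = snd @` (H `&` [set p | p.1 = x])).
  apply: continuous_compact; first by apply: continuous_subspaceT => p; exact: cvg_snd.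
  apply: compact_closedI => //.
  rewrite (_ : [set p | _] = fst @^-1` [set x])//.
  by apply: preimage_closed; [move=> p _; exact: cvg_fst|exact: closed_eq].
apply/seteqP; split=> [y Hy|y [[x' y'] [/= Hp xx'] <-]]; first by exists (x, y).
by rewrite -xx'.
Qed.

Let mid_convex a b s : H a -> H b -> 0 <= s <= 1 ->
  H (s * a.1 + (1 - s) * b.1, s * a.2 + (1 - s) * b.2).
Proof. by have /convex_setP := cvH; apply. Qed.

Lemma proj_bounds p : H p -> m <= p.1 <= M.
Proof.
by move=> Hp; rewrite /xmin /xmax compact_ge_inf ?compact_le_sup//; exists p.
Qed.

(** The segment from a leftmost to a rightmost point of [H] crosses every vertical line between
    them. *)
Lemma section_nonempty x : m <= x <= M -> [set y | H (x, y)] !=set0.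
Proof.
move=> /andP[mx xM].
have P0 : [set p.1 | p in H] !=set0 by case: H0 => p Hp; exists p.1, p.
have [a Ha am] := compact_inf_mem cproj P0.
have [b Hb bM] := compact_sup_mem cproj P0.
move: mx xM; rewrite /xmin /xmax -am -bM => ax xb.
have [ab|ab] := eqVneq a.1 b.1.
  by exists a.2; rewrite /= (_ : x = a.1) -?surjective_pairing//; lra.
have ab0 : 0 < b.1 - a.1 by rewrite subr_gt0 lt_neqAle ab (le_trans ax).
have s01 : 0 <= (b.1 - x) / (b.1 - a.1) <= 1.
  by rewrite divr_ge0 ?(ltW ab0) ?subr_ge0//= ler_pdivrMr// mul1r; lra.
have := mid_convex Ha Hb s01.
set s := _ / _; rewrite (_ : s * a.1 + _ = x); first by exists (s * a.2 + (1 - s) * b.2).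
by rewrite /s; field; rewrite gt_eqF.
Qed.

Lemma mem_section x y : H (x, y) <-> m <= x <= M /\ ybot H x <= y <= ytop H x.
Proof.
split=> [Hxy|[/section_nonempty s0 /andP[by1 yt]]].
  split; first exact: (proj_bounds Hxy).
  by rewrite /ybot /ytop (compact_ge_inf (@csec x))//= (compact_le_sup (@csec x)).
have Hb := compact_inf_mem (@csec x) s0; have Ht := compact_sup_mem (@csec x) s0.
move: Hb Ht by1 yt; rewrite /= -/(ybot H x) -/(ytop H x).
move: (ybot H x) (ytop H x) => u v Hu Hv uy yv.
have [uv|uv] := eqVneq u v; first by rewrite (_ : y = u)//; lra.
have uv0 : 0 < v - u by rewrite subr_gt0 lt_neqAle uv (le_trans uy).
have s01 : 0 <= (v - y) / (v - u) <= 1.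
  by rewrite divr_ge0 ?(ltW uv0) ?subr_ge0//= ler_pdivrMr// mul1r; lra.
have := mid_convex Hu Hv s01; set s := _ / _ => /=.
rewrite (_ : s * x + _ = x); last by ring.
by rewrite (_ : s * u + _ = y)// /s; field; rewrite gt_eqF.
Qed.

Lemma ytop_mem x : m <= x <= M -> H (x, ytop H x).
Proof. by move=> /section_nonempty; exact: compact_sup_mem. Qed.

Lemma ybot_mem x : m <= x <= M -> H (x, ybot H x).
Proof. by move=> /section_nonempty; exact: compact_inf_mem. Qed.

Let chord_mem x1 x2 x3 y1 y3 : x1 < x2 -> x2 < x3 -> H (x1, y1) -> H (x3, y3) ->
  H (x2, ((x3 - x2) * y1 + (x2 - x1) * y3) / (x3 - x1)).
Proof.
move=> x12 x23 H1 H3; have x0 : 0 < x3 - x1 by lra.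
have s01 : 0 <= (x3 - x2) / (x3 - x1) <= 1.
  by rewrite divr_ge0 ?(ltW x0) ?subr_ge0 ?(ltW x23)//= ler_pdivrMr// mul1r; lra.
have := mid_convex H1 H3 s01; congr (H (_, _)) => /=; field; rewrite gt_eqF//.
Qed.

(** The segment between two points of the upper boundary lies in [H], hence below that boundary. *)
Lemma dev_ytop x1 x2 x3 : m <= x1 -> x1 < x2 -> x2 < x3 -> x3 <= M ->
  0 <= dev (ytop H) x1 x2 x3.
Proof.
move=> m1 x12 x23 x3M; have x0 : 0 < x3 - x1 by lra.
have /mem_section[_ /andP[_]] := chord_mem x12 x23
  (@ytop_mem x1 ltac:(apply/andP; lra)) (@ytop_mem x3 ltac:(apply/andP; lra)).
by rewrite ler_pdivrMr// /dev; lra.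
Qed.

Lemma dev_ybot x1 x2 x3 : m <= x1 -> x1 < x2 -> x2 < x3 -> x3 <= M ->
  dev (ybot H) x1 x2 x3 <= 0.
Proof.
move=> m1 x12 x23 x3M; have x0 : 0 < x3 - x1 by lra.
have /mem_section[_ /andP[+ _]] := chord_mem x12 x23
  (@ybot_mem x1 ltac:(apply/andP; lra)) (@ybot_mem x3 ltac:(apply/andP; lra)).
by rewrite ler_pdivlMr// /dev; lra.
Qed.

Let section_outside x : ~~ (m <= x <= M) -> [set y | H (x, y)] = set0.
Proof.
by move=> xmM; apply/seteqP; split=> y //= /proj_bounds xy; rewrite xy in xmM.
Qed.

Lemma measurable_ytop : measurable_fun [set: mR] (ytop H : mR -> mR).
Proof.
apply: (measurable_concave dev_ytop) => x xmM.
(* The supremum of the empty set is 0 by convention, the value that [measurable_concave] prescribes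
   outside the interval. *)
by rewrite /ytop section_outside// sup0.
Qed.

Lemma measurable_ybot : measurable_fun [set: mR] (ybot H : mR -> mR).
Proof.
rewrite (_ : ybot H = -%R \o (fun x => - ybot H x)); last first.
  by apply/funext => x /=; rewrite opprK.
apply: measurableT_comp => //; apply: (@measurable_concave _ m M) => [x1 x2 x3 m1 x12 x23 x3M|x xmM].
  by have := dev_ybot m1 x12 x23 x3M; rewrite /dev; lra.
by rewrite /ybot section_outside// inf0 oppr0.
Qed.

Lemma measurable_W : measurable_fun [set: mR] (W H : mR -> mR).
Proof. exact: measurable_funB measurable_ytop measurable_ybot. Qed.

Definition midpoint (x : R) : R := (ytop H x + ybot H x) / 2.
Definition half_width (x : R) : R := W H x / 2.

Local Notation body := (body m M (W H)).
Local Notation admissible := (admissible m M (W H)).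

Lemma body_midpoint : H = body midpoint.
Proof.
apply/seteqP; split=> -[x y]; rewrite /body /= ler_norml /midpoint /W.
  by move=> /mem_section[-> /andP[? ?]]; apply/andP; split; lra.
by move=> /andP[xmM /andP[? ?]]; apply/mem_section; split=> //; apply/andP; split; lra.
Qed.

Lemma Sym_body : Sym H = body (fun=> 0).
Proof.
apply/seteqP; split=> -[x y]; rewrite /Sym /body /= subr0; first by move=> [-> ->].
by move=> /andP[-> ->].
Qed.

Lemma Sha_body : Sha H = body half_width.
Proof.
apply/seteqP; split=> -[x y]; rewrite /Sha /body /half_width /= ler_norml.
  by move=> [-> /andP[? ?]]; apply/andP; split; lra.
by move=> /andP[-> /andP[? ?]]; split=> //; apply/andP; split; lra.
Qed.

(** Adding or subtracting half the width gives [ytop] or [ybot], so the two bounds are the concavity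
    of the one and the convexity of the other. *)
Lemma admissible_midpoint : admissible midpoint.
Proof.
split=> [|x1 x2 x3 m1 x12 x23 x3M].
  apply: measurable_funM => //; exact: measurable_funD measurable_ytop measurable_ybot.
have := dev_ytop m1 x12 x23 x3M; have := dev_ybot m1 x12 x23 x3M.
by rewrite /dev /midpoint /W ler_norml => ? ?; apply/andP; split; lra.
Qed.

Lemma admissible_half_width : admissible half_width.
Proof.
split=> [|x1 x2 x3 m1 x12 x23 x3M].
  by apply: measurable_funM => //; exact: measurable_W.
have := dev_ytop m1 x12 x23 x3M; have := dev_ybot m1 x12 x23 x3M.
by rewrite /dev /half_width /W ler_norml => ? ?; apply/andP; split; lra.
Qed.

Lemma area_Sym : exists2 A : R, 0 < A & lebesgue_plane (body (fun=> 0)) = A%:E.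
Proof.
have mH := compact_plane_measurable cH.
have Hpos := lebesgue_plane_interior_gt0 mH iH.
have Hfin := lebesgue_plane_compact_lty cH.
have e : lebesgue_plane (body (fun=> 0)) = lebesgue_plane H.
  rewrite -(shear_body m M (W H) midpoint) lebesgue_plane_shear -?body_midpoint//.
exists (fine (lebesgue_plane H)); first by rewrite fine_gt0// Hpos.
by rewrite e fineK// ge0_fin_numE// ltW.
Qed.

Lemma Q_Sym_Sha n : n = 4%N \/ n = 5%N ->
  (Q n (Sym H) >= Q n H)%E /\ (Q n (Sha H) <= Q n H)%E.
Proof.
move=> n45; have [A A0 areaA] := area_Sym.
have ac := admissible_midpoint; have ah := admissible_half_width.
have a0 := admissible_zero ac.
rewrite Sym_body Sha_body; split.
  rewrite [X in (Q n X <= _)%E]body_midpoint; apply: (Q_body_le measurable_W A0 areaA a0 ac) n45.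
  by move=> x1 x2 x3 _ _ _ _; rewrite /dev !mulr0 !subr0 normr0.
rewrite [X in (_ <= Q n X)%E]body_midpoint; apply: (Q_body_le measurable_W A0 areaA ac ah) n45.
(* The bound that admissibility puts on [dev midpoint] is exactly [dev half_width]. *)
move=> x1 x2 x3 m1 x12 x23 x3M; apply: le_trans (ler_norm _).
have := ac.2 _ _ _ m1 x12 x23 x3M; congr (_ <= _).
by rewrite /dev /half_width; field.
Qed.

End convex_bodies.

Theorem theorem3 (R : realType) (n : nat) (H : set (R * R)) :
  n = 4%N \/ n = 5%N ->
  compact H ->
  @convex_set R (R * R)%type H ->
  interior H !=set0 ->
  (Q n (Sym H) >= Q n H)%E /\ (Q n (Sha H) <= Q n H)%E.
Proof. by move=> n45 cH cvH iH; exact: Q_Sym_Sha. Qed.
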